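(* The products $\cdot$, $\nwarrow$ and the coproducts $\Delta_\prec,\Delta_\succ$ described in the context make $\mathbf{FQSym}^+$ a $Dup$-$Dend$ bialgebra. Moreover, $\Theta:\mathcal{H}_{\mathcal{SP}}^+\longrightarrow\mathbf{FQSym}^+$ is a morphism of $Dup$-$Dend$ bialgebras (i.e. it is compatible with both products and both coproducts).
   Context: $\mathbb{K}$ is a commutative field. Structure on permutations. $\mathbf{FQSym}^+$ is the $\mathbb{K}$-vector space with basis $\bigsqcup_{n\geq1}\mathfrak{S}_n$; permutations are written as words $\sigma(1)\ldots\sigma(n)$. For $\sigma\in\mathfrak{S}_k,\tau\in\mathfrak{S}_l$ ($k,l\ge1$), $\sigma\cdot\tau$ is the sum of all shuffles of the word $\sigma$ and the word $\tau$ whose letters are shifted by $k$; $\sigma\nwarrow\tau$ is the sum of those shuffles in which all the (shifted) letters of $\tau$ come after the greatest letter $k$ of $\sigma$. For $\sigma\in\mathfrak{S}_n$ and $1\leq k\leq n-1$ let $\sigma_1^{(k)},\sigma_2^{(k)}$ be the standardizations of $\sigma(1)\ldots\sigma(k)$ and $\sigma(k+1)\ldots\sigma(n)$, and $\Delta_\prec(\sigma)=\sum_{k=\sigma^{-1}(n)}^{n-1}\sigma_1^{(k)}\otimes\sigma_2^{(k)}$, $\Delta_\succ(\sigma)=\sum_{k=1}^{\sigma^{-1}(n)-1}\sigma_1^{(k)}\otimes\sigma_2^{(k)}$. Structure on special posets. A special poset is a finite set with two partial orders $(P,\leq_1,\leq_2)$ with $\leq_2$ total, up to isomorphism; $(P,\leq_2)$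 is identified with $\{1,\ldots,n\}$, $n=|P|$. Subsets are special posets by restriction. $\mathcal{H}_{\mathcal{SP}}^+$ has basis the nonempty special posets. $PQ$ is the disjoint union with $P,Q$ as subposets, $x\leq_2 y$ for $x\in P,y\in Q$, and no $\leq_1$-comparabilities between $P$ and $Q$. With $g_P$ the maximum of $(P,\leq_2)$, $P\nwarrow Q$ is the disjoint union with $P,Q$ as subposets and, for $x\in P,y\in Q$: $x\leq_2 y$; $x\leq_1 y$ iff $x\leq_1 g_P$ (never $y\leq_1 x$). $\Delta_\prec(P)$ (resp. $\Delta_\succ(P)$) is $\sum_I(P\setminus I)\otimes I$ over the subsets $I\neq\emptyset,P$ such that ($x\in I$, $x\leq_1 y$ imply $y\in I$) with $g_P\notin I$ (resp. $g_P\in I$). With these, $\mathcal{H}_{\mathcal{SP}}^+$ is a $Dup$-$Dend$ bialgebra. $\Theta(P)=\sum_{\sigma\in S_P}\sigma$, where $S_P$ is the set of $\sigma\in\mathfrak{S}_n$ such that $i<_1 j$ implies $\sigma^{-1}(i)<\sigma^{-1}(j)$. A $Dup$-$Dend$ bialgebra is a vector space $A$ with two products $\cdot$ (juxtaposition), $\nwarrow$ and two coproducts $\Delta_\prec,\Delta_\succ:A\to A\otimes A$ such that, with $\tilde\Delta=\Delta_\prec+\Delta_\succ$: (i) $(xy)z=x(yz)$, $(x\nwarrow y)\nwarrow z=x\nwarrow(y\nwarrow z)$, $(xy)\nwarrow z=x(y\nwarrow z)$; (ii) $(\Delta_\prec\otimes Id)\circ\Delta_\prec=(Id\otimes\tilde\Delta)\circ\Delta_\prec$,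 $(\Delta_\succ\otimes Id)\circ\Delta_\prec=(Id\otimes\Delta_\prec)\circ\Delta_\succ$, $(\tilde\Delta\otimes Id)\circ\Delta_\succ=(Id\otimes\Delta_\succ)\circ\Delta_\succ$; (iii) with Sweedler notations $\tilde\Delta(a)=a'\otimes a''$, $\Delta_\prec(a)=a'_\prec\otimes a''_\prec$, $\Delta_\succ(a)=a'_\succ\otimes a''_\succ$: $\Delta_\prec(xy)=y\otimes x+y'_\prec\otimes xy''_\prec+xy'_\prec\otimes y''_\prec+x'y\otimes x''+x'y'_\prec\otimes x''y''_\prec$, $\Delta_\succ(xy)=x\otimes y+xy'_\succ\otimes y''_\succ+y'_\succ\otimes xy''_\succ+x'\otimes x''y+x'y'_\succ\otimes x''y''_\succ$, $\Delta_\prec(x\nwarrow y)=x\nwarrow y'_\prec\otimes y''_\prec+x'_\prec\nwarrow y\otimes x''_\prec+x'_\prec\nwarrow y'_\prec\otimes x''_\prec y''_\prec$, $\Delta_\succ(x\nwarrow y)=x\otimes y+x\nwarrow y'_\succ\otimes y''_\succ+x'_\succ\otimes x''_\succ\nwarrow y+x'_\prec\otimes x''_\prec y+x'_\prec\nwarrow y'_\succ\otimes x''_\prec y''_\succ$, where $\nwarrow$ and the product bind more tightly than $\otimes$. *)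

(* Defs.v *)
From HB Require Import structures.
From mathcomp Require Import all_boot all_order all_algebra all_fingroup.
From mathcomp Require Import finmap.
From mathcomp.multinomials Require Import monalg.

Set Implicit Arguments.
Unset Strict Implicit.
Unset Printing Implicit Defensive.

Import GRing.Theory.

Local Open Scope ring_scope.

(** * Tensor products *)

Definition bilinear_map (K : fieldType) (U V W : lmodType K)
    (f : U -> V -> W) : Prop :=
  (forall v, linear (f^~ v)) /\ (forall u, linear (f u)).

(* A tensor product of U and V: a vector space with a universal bilinear map.
   [tlift T f t] applies f in Sweedler notation: if t is a sum of t' ⊗ t'',
   then [tlift T f t] is the sum of the f t' t''. *)
Record tensor (K : fieldType) (U V : lmodType K) := Tensor {
  tspace :> lmodType K;
  tmul : U -> V -> tspace;
  tlift : forall W : lmodType K, (U -> V -> W) -> tspace -> W;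
  tmul_bilinear : bilinear_map tmul;
  tlift_linear : forall (W : lmodType K) (f : U -> V -> W),
    bilinear_map f -> linear (tlift f);
  tlift_tmul : forall (W : lmodType K) (f : U -> V -> W),
    bilinear_map f -> forall u v, tlift f (tmul u v) = f u v;
  tensor_ext : forall (W : lmodType K) (g h : tspace -> W),
    linear g -> linear h ->
    (forall u v, g (tmul u v) = h (tmul u v)) -> g =1 h
}.

Arguments tmul {K U V t} u v.
Arguments tlift {K U V} t {W} f x.

Notation "u ⊗ v" := (tmul u v) (at level 45, no associativity) : ring_scope.

(** * Dup-Dend bialgebras *)

Record dupdend_ops (K : fieldType) (A : lmodType K) (AA : tensor A A) :=
  DupDendOps {
    ddmul : A -> A -> A;
    ddnw : A -> A -> A;
    ddprec : A -> AA;
    ddsucc : A -> AA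
  }.

Section DupDend.
Context (K : fieldType) (A : lmodType K) (AA : tensor A A) (AAA : tensor A AA).

Definition ddtilde (O : dupdend_ops AA) (x : A) : AA :=
  ddprec O x + ddsucc O x.

(* D ⊗ Id, followed by the identification of (A ⊗ A) ⊗ A with A ⊗ (A ⊗ A). *)
Definition tensor_idr (D : A -> AA) : AA -> AAA :=
  tlift AA (fun a b => tlift AA (fun a1 a2 => a1 ⊗ (a2 ⊗ b)) (D a)).

(* Id ⊗ D *)
Definition tensor_idl (D : A -> AA) : AA -> AAA :=
  tlift AA (fun a b => a ⊗ D b).

Record dupdend_bialgebra (O : dupdend_ops AA) : Prop := {
  ddmul_bilinear : bilinear_map (ddmul O);
  ddnw_bilinear : bilinear_map (ddnw O);
  ddprec_linear : linear (ddprec O);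
  ddsucc_linear : linear (ddsucc O);

  dd_mulA : forall x y z,
    ddmul O (ddmul O x y) z = ddmul O x (ddmul O y z);
  dd_nwA : forall x y z,
    ddnw O (ddnw O x y) z = ddnw O x (ddnw O y z);
  dd_mul_nw : forall x y z,
    ddnw O (ddmul O x y) z = ddmul O x (ddnw O y z);

  dd_prec_prec : forall x,
    tensor_idr (ddprec O) (ddprec O x) = tensor_idl (ddtilde O) (ddprec O x);
  dd_succ_prec : forall x,
    tensor_idr (ddsucc O) (ddprec O x) = tensor_idl (ddprec O) (ddsucc O x);
  dd_tilde_succ : forall x,
    tensor_idr (ddtilde O) (ddsucc O x) = tensor_idl (ddsucc O) (ddsucc O x);

  dd_prec_mul : forall x y,
    ddprec O (ddmul O x y) =
      y ⊗ x
      + tlift AA (fun y1 y2 => y1 ⊗ ddmul O x y2) (ddprec O y)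
      + tlift AA (fun y1 y2 => ddmul O x y1 ⊗ y2) (ddprec O y)
      + tlift AA (fun x1 x2 => ddmul O x1 y ⊗ x2) (ddtilde O x)
      + tlift AA (fun x1 x2 =>
          tlift AA (fun y1 y2 => ddmul O x1 y1 ⊗ ddmul O x2 y2) (ddprec O y))
          (ddtilde O x);
  dd_succ_mul : forall x y,
    ddsucc O (ddmul O x y) =
      x ⊗ y
      + tlift AA (fun y1 y2 => ddmul O x y1 ⊗ y2) (ddsucc O y)
      + tlift AA (fun y1 y2 => y1 ⊗ ddmul O x y2) (ddsucc O y)
      + tlift AA (fun x1 x2 => x1 ⊗ ddmul O x2 y) (ddtilde O x)
      + tlift AA (fun x1 x2 =>
          tlift AA (fun y1 y2 => ddmul O x1 y1 ⊗ ddmul O x2 y2) (ddsucc O y))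
          (ddtilde O x);
  dd_prec_nw : forall x y,
    ddprec O (ddnw O x y) =
      tlift AA (fun y1 y2 => ddnw O x y1 ⊗ y2) (ddprec O y)
      + tlift AA (fun x1 x2 => ddnw O x1 y ⊗ x2) (ddprec O x)
      + tlift AA (fun x1 x2 =>
          tlift AA (fun y1 y2 => ddnw O x1 y1 ⊗ ddmul O x2 y2) (ddprec O y))
          (ddprec O x);
  dd_succ_nw : forall x y,
    ddsucc O (ddnw O x y) =
      x ⊗ y
      + tlift AA (fun y1 y2 => ddnw O x y1 ⊗ y2) (ddsucc O y)
      + tlift AA (fun x1 x2 => x1 ⊗ ddnw O x2 y) (ddsucc O x)
      + tlift AA (fun x1 x2 => x1 ⊗ ddmul O x2 y) (ddprec O x)
      + tlift AA (fun x1 x2 =>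
          tlift AA (fun y1 y2 => ddnw O x1 y1 ⊗ ddmul O x2 y2) (ddsucc O y))
          (ddprec O x)
}.

End DupDend.

Definition tensor_map (K : fieldType) (A B : lmodType K) (AA : tensor A A)
    (BB : tensor B B) (f : A -> B) : AA -> BB :=
  tlift AA (fun a1 a2 => f a1 ⊗ f a2).

Record dupdend_morphism (K : fieldType) (A B : lmodType K) (AA : tensor A A)
    (BB : tensor B B) (OA : dupdend_ops AA) (OB : dupdend_ops BB)
    (f : A -> B) : Prop := {
  ddm_linear : linear f;
  ddm_mul : forall x y, f (ddmul OA x y) = ddmul OB (f x) (f y);
  ddm_nw : forall x y, f (ddnw OA x y) = ddnw OB (f x) (f y);
  ddm_prec : forall x, ddprec OB (f x) = tensor_map BB f (ddprec OA x);
  ddm_succ : forall x, ddsucc OB (f x) = tensor_map BB f (ddsucc OA x)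
}.

(** * Vector spaces with a basis *)

(* [{malg K[B]}] is the vector space with basis B; [<< b >>] is the basis
   vector b. *)

Section Free.
Context (K : fieldType).

Definition linext (B : choiceType) (W : lmodType K) (f : B -> W)
    (x : {malg K[B]}) : W :=
  \sum_(b <- msupp x) x@_b *: f b.

Definition bilinext (B C : choiceType) (W : lmodType K) (f : B -> C -> W)
    (x : {malg K[B]}) (y : {malg K[C]}) : W :=
  linext (fun b => linext (f b) y) x.

Lemma linextEw (B : choiceType) (W : lmodType K) (f : B -> W)
    (d : {fset B}) (x : {malg K[B]}) :
  (msupp x `<=` d)%fset -> linext f x = \sum_(b <- d) x@_b *: f b.
Proof.
move=> le_xd; rewrite /linext (big_fset_incl _ le_xd) // => b _ /mcoeff_outdom.
by move=> ->; rewrite scale0r.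
Qed.

Lemma linext_linear (B : choiceType) (W : lmodType K) (f : B -> W) :
  linear (linext f).
Proof.
move=> a x y; pose d := (msupp x `|` msupp y)%fset.
have le_d : (msupp (a *: x + y) `<=` d)%fset.
  apply: fsubset_trans (msuppD_le _ _) _.
  exact: fsetSU (msuppZ_le _ _).
rewrite (linextEw f le_d) (@linextEw _ _ f d x) ?fsubsetUl //.
rewrite (@linextEw _ _ f d y) ?fsubsetUr // scaler_sumr -big_split /=.
by apply: eq_bigr => b _; rewrite mcoeffD mcoeffZ scalerDl scalerA.
Qed.

Lemma linextU (B : choiceType) (W : lmodType K) (f : B -> W) (b : B) :
  linext f << b >> = f b.
Proof. by rewrite /linext msuppU oner_eq0 big_seq_fset1 mcoeffUU scale1r. Qed.

Lemma malg_linextE (B : choiceType) (x : {malg K[B]}) :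
  x = linext (fun b => << b >>) x.
Proof.
rewrite {1}[x]monalgE; apply: eq_bigr => b _.
by apply/malgP => c; rewrite mcoeffZ !mcoeffU mulrnAr mulr1.
Qed.

Lemma linear_linext (B : choiceType) (V W : lmodType K) (g : V -> W)
    (f : B -> V) (x : {malg K[B]}) :
  linear g -> g (linext f x) = linext (fun b => g (f b)) x.
Proof.
move=> g_lin; rewrite /linext.
have gD : {morph g : u v / u + v} by move=> u v; rewrite -[u]scale1r g_lin !scale1r.
have g0 : g 0 = 0 by apply: (addIr (g 0)); rewrite -gD !add0r.
rewrite (big_morph g gD g0); apply: eq_bigr => b _.
by rewrite -[_ *: f b]addr0 g_lin g0 addr0.
Qed.

Lemma bilinext_bilinear (B C : choiceType) (W : lmodType K)
    (f : B -> C -> W) : bilinear_map (bilinext f).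
Proof.
split=> [y | x]; first exact: linext_linear.
move=> a y z; rewrite /bilinext /linext scaler_sumr -big_split /=.
apply: eq_bigr => b _; rewrite -![\sum_(_ <- _) _]/(linext (f b) _) linext_linear.
by rewrite scalerDr !scalerA mulrC.
Qed.

Lemma bilinextU (B C : choiceType) (W : lmodType K) (f : B -> C -> W) b c :
  bilinext f << b >> << c >> = f b c.
Proof. by rewrite /bilinext !linextU. Qed.

Lemma bilinear_bilinext (B C : choiceType) (W : lmodType K)
    (f : {malg K[B]} -> {malg K[C]} -> W) x y :
  bilinear_map f -> f x y = bilinext (fun b c => f << b >> << c >>) x y.
Proof.
move=> [f_linl f_linr]; rewrite {1}[x]malg_linextE.
rewrite (linear_linext _ _ (f_linl y)) /bilinext.
apply: eq_bigr => b _; congr (_ *: _).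
by rewrite {1}[y]malg_linextE (linear_linext _ _ (f_linr _)).
Qed.

Section MalgTensor.
Context (B C : choiceType).

Definition malg_tmul : {malg K[B]} -> {malg K[C]} -> {malg K[(B * C)%type]} :=
  bilinext (fun b c => << (b, c) >>).

Definition malg_tlift (W : lmodType K)
    (f : {malg K[B]} -> {malg K[C]} -> W) : {malg K[(B * C)%type]} -> W :=
  linext (fun p => f << p.1 >> << p.2 >>).

Lemma malg_tlift_tmul (W : lmodType K) (f : {malg K[B]} -> {malg K[C]} -> W) :
  bilinear_map f -> forall u v, malg_tlift f (malg_tmul u v) = f u v.
Proof.
move=> f_bil u v; rewrite (bilinear_bilinext u v f_bil) /malg_tlift /malg_tmul /bilinext.
rewrite (linear_linext _ _ (linext_linear _)); apply: eq_bigr => b _.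
congr (_ *: _); rewrite (linear_linext _ _ (linext_linear _)).
by apply: eq_bigr => c _; rewrite linextU.
Qed.

Lemma malg_tensor_ext (W : lmodType K) (g h : {malg K[(B * C)%type]} -> W) :
  linear g -> linear h ->
  (forall u v, g (malg_tmul u v) = h (malg_tmul u v)) -> g =1 h.
Proof.
move=> g_lin h_lin eq_gh t; rewrite [t]malg_linextE !linear_linext //.
apply: eq_bigr => -[b c] _; congr (_ *: _).
by have := eq_gh << b >> << c >>; rewrite /malg_tmul bilinextU.
Qed.

Definition malg_tensor : tensor {malg K[B]} {malg K[C]} :=
  @Tensor K _ _ {malg K[(B * C)%type]} malg_tmul malg_tlift
    (bilinext_bilinear _) (fun W f _ => linext_linear _)
    malg_tlift_tmul malg_tensor_ext.

End MalgTensor.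

End Free.

(** * Words *)

Fixpoint shuffle (T : Type) (u v : seq T) {struct u} : seq (seq T) :=
  if u is a :: u' then
    (fix shuffle_u v := if v is b :: v'
      then map (cons a) (shuffle u' v) ++ map (cons b) (shuffle_u v')
      else [:: u]) v
  else [:: v].

Definition shift (k : nat) (w : seq nat) : seq nat := [seq (k + a)%N | a <- w].

(* The word σ(1)...σ(n), with letters 1, ..., n. *)
Definition word (n : nat) (s : 'S_n) : seq nat := [seq (s i).+1 | i : 'I_n].

(* Standardization of a word. Equal letters, which do not occur below, are
   ranked from left to right. *)
Section Standardization.
Context (w : seq nat).

Definition std_lt (j i : 'I_(size w)) : bool :=
  let a := nth 0%N w j in let b := nth 0%N w i in
  (a < b)%N || (a == b) && (j < i)%N.

Lemma std_rank_subproof (i : 'I_(size w)) :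
  (#|[set j | std_lt j i]| < size w)%N.
Proof.
rewrite -[X in (_ < X)%N]card_ord -cardsT; apply: proper_card.
apply/properP; split; first exact: subsetT.
by exists i; rewrite ?inE // /std_lt !ltnn andbF.
Qed.

Definition std_rank (i : 'I_(size w)) : 'I_(size w) :=
  Ordinal (std_rank_subproof i).

Lemma std_rank_inj : injective std_rank.
Proof.
have lt_rank i j : std_lt i j -> (std_rank i < std_rank j)%N.
  rewrite /std_lt => lt_ij; apply: proper_card; apply/properP; split.
    apply/subsetP => k; rewrite !inE /std_lt; move: lt_ij => /=.
    case: ltngtP => //= [lt_ij _|-> lt_ij].
      case: ltngtP => //= [lt_ki _|-> _]; last by rewrite lt_ij.
      by rewrite (ltn_trans lt_ki lt_ij).
    by case: ltngtP => //= _ /ltn_trans->.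
  by exists i; rewrite !inE /std_lt // !ltnn andbF.
move=> i j eq_ij; case: (ltngtP (nth 0%N w i) (nth 0%N w j)) => [lt|gt|eq].
- by have := @lt_rank i j; rewrite eq_ij ltnn /std_lt lt => /(_ isT).
- by have := @lt_rank j i; rewrite eq_ij ltnn /std_lt gt => /(_ isT).
apply: val_inj => /=; case: (ltngtP i j) => // [lt|gt].
- by have := @lt_rank i j; rewrite eq_ij ltnn /std_lt eq eqxx lt orbT => /(_ isT).
- by have := @lt_rank j i; rewrite eq_ij ltnn /std_lt eq eqxx gt orbT => /(_ isT).
Qed.

Definition std : 'S_(size w) := perm std_rank_inj.

End Standardization.

(** * FQSym^+ *)

Definition fq_basis : choiceType := {n : nat & 'S_n.+1}.

Section FQSym.
Context (K : fieldType).

Definition FQSym : lmodType K := {malg K[fq_basis]}.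

Definition FQSym2 : tensor FQSym FQSym := malg_tensor K fq_basis fq_basis.
Definition FQSym3 : tensor FQSym FQSym2 :=
  malg_tensor K fq_basis (fq_basis * fq_basis)%type.

(* The basis vector of a permutation. There is none for the permutation of the
   empty set, which does not occur below. *)
Definition fq_elt (n : nat) : 'S_n -> FQSym :=
  match n with
  | 0 => fun _ => 0
  | m.+1 => fun s => << Tagged (fun n => 'S_n.+1) s : fq_basis >>
  end.

(* The letters being distinct, no shuffle is obtained twice. *)
Definition fq_mulb (s t : fq_basis) : FQSym :=
  let k := (tag s).+1 in let l := (tag t).+1 in
  \sum_(r : 'S_(k + l) |
        word r \in shuffle (word (tagged s)) (shift k (word (tagged t))))
    fq_elt r.

Definition fq_nwb (s t : fq_basis) : FQSym :=
  let k := (tag s).+1 in let l := (tag t).+1 in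
  let t' := shift k (word (tagged t)) in
  \sum_(r : 'S_(k + l) |
        (word r \in shuffle (word (tagged s)) t')
        && all (fun b => index k (word r) < index b (word r))%N t')
    fq_elt r.

(* σ^-1(n), as an element of {1, ..., n}, where σ is a permutation of
   {1, ..., n} *)
Definition fq_max (s : fq_basis) : nat := ((tagged s)^-1%g ord_max).+1.

Definition fq_cut (s : fq_basis) (k : nat) : FQSym2 :=
  fq_elt (std (take k (word (tagged s))))
  ⊗ fq_elt (std (drop k (word (tagged s)))).

Definition fq_precb (s : fq_basis) : FQSym2 :=
  \sum_(fq_max s <= k < (tag s).+1) fq_cut s k.

Definition fq_succb (s : fq_basis) : FQSym2 :=
  \sum_(1 <= k < fq_max s) fq_cut s k.

Definition FQSym_ops : dupdend_ops FQSym2 :=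
  DupDendOps (bilinext fq_mulb) (bilinext fq_nwb)
    (linext fq_precb) (linext fq_succb).

End FQSym.

(** * Special posets *)

(* The total order of a special poset with n elements identifies it with 'I_n
   with its usual order, and this identification is unique. An isomorphism
   class of special posets with n elements is thus a partial order on 'I_n. *)

Definition porder_rel (T : finType) (r : rel T) : bool :=
  [&& [forall x, r x x],
      [forall x, forall y, r x y && r y x ==> (x == y)] &
      [forall x, forall y, forall z, r x y && r y z ==> r x z]].

Lemma porder_relP (T : finType) (r : rel T) :
  reflect [/\ reflexive r, antisymmetric r & transitive r] (porder_rel r).
Proof.
apply: (iffP and3P) => [[rr ra rt]|[rr ra rt]]; split.
- by move=> x; apply: (forallP rr).
- by move=> x y rxy; apply/eqP; apply: (implyP (forallP (forallP ra x) y)).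
- move=> y x z rxy ryz.
  by apply: (implyP (forallP (forallP (forallP rt x) y) z)); rewrite rxy.
- by apply/forallP.
- by apply/forallP => x; apply/forallP => y; apply/implyP => /ra->.
- apply/forallP => x; apply/forallP => y; apply/forallP => z.
  by apply/implyP => /andP[]; apply: rt.
Qed.

Record sposet (n : nat) := SPoset {
  sprel : {ffun 'I_n * 'I_n -> bool};
  _ : porder_rel (fun x y => sprel (x, y))
}.

HB.instance Definition _ n := [isSub for @sprel n].
HB.instance Definition _ n := [Finite of sposet n by <:].

Definition le1 (n : nat) (P : sposet n) : rel 'I_n := fun x y => sprel P (x, y).

Lemma le1_porder n (P : sposet n) :
  [/\ reflexive (le1 P), antisymmetric (le1 P) & transitive (le1 P)].
Proof. exact/porder_relP/(valP P). Qed.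

Lemma sposet_of_subproof n (r : rel 'I_n) (r_po : porder_rel r) :
  porder_rel (fun x y => [ffun p => r p.1 p.2] (x, y)).
Proof.
by move: r_po => /porder_relP[rr ra rt]; apply/porder_relP;
  split=> [x|x y|y x z]; rewrite !ffunE //=; [apply: ra | apply: rt].
Qed.

Definition sposet_of n (r : rel 'I_n) (r_po : porder_rel r) : sposet n :=
  SPoset (sposet_of_subproof r_po).

Lemma sposet_ofE n (r : rel 'I_n) (r_po : porder_rel r) :
  le1 (sposet_of r_po) =2 r.
Proof. by move=> x y; rewrite /le1 ffunE. Qed.

(* In the disjoint unions below, [split] sends 'I_(m + n) to 'I_m + 'I_n, the
   elements of 'I_m coming first for the total order. *)

Section DisjointUnion.
Context (m n : nat) (P : sposet m) (Q : sposet n).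

Definition sp_mul_rel : rel 'I_(m + n) := fun x y =>
  match split x, split y with
  | inl a, inl b => le1 P a b
  | inr a, inr b => le1 Q a b
  | _, _ => false
  end.

Lemma sp_mul_porder : porder_rel sp_mul_rel.
Proof.
have [[Pr Pa Pt] [Qr Qa Qt]] := (le1_porder P, le1_porder Q).
apply/porder_relP; split; rewrite /sp_mul_rel.
- by move=> x; case: (split x).
- move=> x y lexy; apply: (can_inj (@splitK _ _)); move: lexy.
  by case: (split x) => a; case: (split y) => b;
    rewrite ?andbF //; [move/Pa-> | move/Qa->].
- move=> y x z; case: (split x) => a; case: (split y) => b;
    case: (split z) => c //; [exact: Pt | exact: Qt].
Qed.

Definition sp_mul : sposet (m + n) := sposet_of sp_mul_porder.

End DisjointUnion.

Section NorthWest.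
Context (m n : nat) (P : sposet m.+1) (Q : sposet n).

Definition sp_nw_rel : rel 'I_(m.+1 + n) := fun x y =>
  match split x, split y with
  | inl a, inl b => le1 P a b
  | inr a, inr b => le1 Q a b
  | inl a, inr _ => le1 P a ord_max
  | inr _, inl _ => false
  end.

Lemma sp_nw_porder : porder_rel sp_nw_rel.
Proof.
have [[Pr Pa Pt] [Qr Qa Qt]] := (le1_porder P, le1_porder Q).
apply/porder_relP; split; rewrite /sp_nw_rel.
- by move=> x; case: (split x).
- move=> x y lexy; apply: (can_inj (@splitK _ _)); move: lexy.
  by case: (split x) => a; case: (split y) => b;
    rewrite ?andbF //; [move/Pa-> | move/Qa->].
- move=> y x z; case: (split x) => a; case: (split y) => b;
    case: (split z) => c //; [exact: Pt | exact: Pt | exact: Qt].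
Qed.

Definition sp_nw : sposet (m.+1 + n) := sposet_of sp_nw_porder.

End NorthWest.

(* [enum_val] lists the elements of I in increasing order. *)
Section Restriction.
Context (n : nat) (P : sposet n) (I : {set 'I_n}).

Definition sp_res_rel : rel 'I_#|I| := fun x y =>
  le1 P (enum_val x) (enum_val y).

Lemma sp_res_porder : porder_rel sp_res_rel.
Proof.
have [Pr Pa Pt] := le1_porder P; apply/porder_relP; split=> [x|x y|y x z] /=.
- exact: Pr.
- by move/Pa/enum_val_inj.
- exact: Pt.
Qed.

Definition sp_res : sposet #|I| := sposet_of sp_res_porder.

Definition upper : bool :=
  [forall x in I, forall y, le1 P x y ==> (y \in I)].

End Restriction.

Definition sp_basis : choiceType := {n : nat & sposet n.+1}.

Section HSP.
Context (K : fieldType).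

Definition HSP : lmodType K := {malg K[sp_basis]}.

Definition HSP2 : tensor HSP HSP := malg_tensor K sp_basis sp_basis.

(* The basis vector of a special poset. There is none for the empty special
   poset, which does not occur below. *)
Definition sp_elt (n : nat) : sposet n -> HSP :=
  match n with
  | 0 => fun _ => 0
  | m.+1 => fun P => << Tagged (fun n => sposet n.+1) P : sp_basis >>
  end.

Definition sp_mulb (P Q : sp_basis) : HSP :=
  sp_elt (sp_mul (tagged P) (tagged Q)).

Definition sp_nwb (P Q : sp_basis) : HSP :=
  sp_elt (sp_nw (tagged P) (tagged Q)).

Definition sp_cut (P : sp_basis) (I : {set 'I_(tag P).+1}) : HSP2 :=
  sp_elt (sp_res (tagged P) (~: I)) ⊗ sp_elt (sp_res (tagged P) I).

Definition sp_precb (P : sp_basis) : HSP2 :=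
  \sum_(I : {set 'I_(tag P).+1} |
        [&& upper (tagged P) I, I != set0, I != setT & ord_max \notin I])
    sp_cut I.

Definition sp_succb (P : sp_basis) : HSP2 :=
  \sum_(I : {set 'I_(tag P).+1} |
        [&& upper (tagged P) I, I != set0, I != setT & ord_max \in I])
    sp_cut I.

Definition HSP_ops : dupdend_ops HSP2 :=
  DupDendOps (bilinext sp_mulb) (bilinext sp_nwb)
    (linext sp_precb) (linext sp_succb).

Definition Theta_b (P : sp_basis) : FQSym K :=
  \sum_(s : 'S_(tag P).+1 |
        [forall i, forall j, (i != j) && le1 (tagged P) i j ==>
                             (s^-1%g i < s^-1%g j)%N])
    fq_elt K s.

Definition Theta : HSP -> FQSym K := linext Theta_b.

End HSP.

(* Main.v *)
Require Import Defs.
From mathcomp Require Import all_boot all_algebra all_fingroup.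
From mathcomp Require Import finmap.
From mathcomp.multinomials Require Import monalg.
From mathcomp Require Import zify.

(** All the operations act on words rather than on permutations.  Write [fq_word w]
    for the basis vector of the standardization of a word [w] with distinct
    letters, with [fq_word [::] = 0].  Standardization only sees the relative
    order of the letters, so it commutes with shuffling and cutting, and the four
    operations become formulas on arbitrary words:
    - if all the letters of [u] are below those of [v], the product of [fq_word u]
      and [fq_word v] is the sum of [fq_word w] over the shuffles [w] of [u] and
      [v] ([mul_fq_word]); for the north-west product, only the shuffles in which
      [v] starts after the greatest letter of [u] are kept ([nw_fq_word]);
    - the two coproducts of [fq_word w] are sums over the cuts of [w] into a prefix
      and a suffix; the greatest letter lies in the prefix for the first one and in
      the suffix for the second one ([prec_fq_word], [succ_fq_word]).

    The laws of a Dup-Dend bialgebra are then facts about words.  Associativity: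
    both sides enumerate the same shuffles of three words ([shuffle_assoc],
    [shuffle_nw_shuffle_assoc], [nw_shuffle_assoc]).  Codendriform laws: both sides
    enumerate the cuts of a word into three factors, with the greatest letter in a
    prescribed factor ([splits_coassoc]).  Compatibility: cutting a shuffle of [u]
    and [v] amounts to cutting [u] and [v] and shuffling the prefixes and the
    suffixes ([splits_shuffle], [splits_nw_shuffle]); the many terms of the
    compatibility formulas only separate the cases where one of the four pieces is
    empty.  Letting empty cuts into the sums, at no cost since [fq_word [::] = 0],
    turns each formula into a single double sum ([coproduct_mul], [coproduct_nw]).

    For the morphism, [Theta P] is the sum of the words that are linear extensions
    of [P] ([ThetaE]), and standardizing the linear extensions of a subset gives
    those of the induced special poset ([Theta_res]).  A linear extension of the
    product of [P] and [Q] is a shuffle of one of [P] and one of [Q]; for the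
    north-west product, the elements of [Q] moreover follow the greatest element of
    [P] ([follows_mul], [follows_nw]).  Cutting a linear extension of [P] gives an
    upper set, the letters of the suffix, together with a linear extension of it
    and one of its complement ([coproduct_extsum]). *)

Set Implicit Arguments.
Unset Strict Implicit.
Unset Printing Implicit Defensive.

Import GRing.Theory.

Local Open Scope ring_scope.

#[local] Arguments shuffle : simpl never.
#[local] Arguments tmul : simpl never.
#[local] Arguments tlift : simpl never.
#[local] Arguments ddmul : simpl never.
#[local] Arguments ddnw : simpl never.
#[local] Arguments ddprec : simpl never.
#[local] Arguments ddsucc : simpl never.

(** * Shuffles and cuts of words *)

Lemma shuffle_nilr (T : Type) (u : seq T) : shuffle u [::] = [:: u].
Proof. by case: u. Qed.

Lemma shuffle_cons (T : Type) (a : T) u b v :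
  shuffle (a :: u) (b :: v) =
  map (cons a) (shuffle u (b :: v)) ++ map (cons b) (shuffle (a :: u) v).
Proof. by []. Qed.

Lemma map_shuffle (T T' : Type) (f : T -> T') u v :
  shuffle (map f u) (map f v) = map (map f) (shuffle u v).
Proof.
elim: u v => [|a u IHu] //; elim=> [|b v IHv] //.
rewrite [map f (a :: u)]/= [map f (b :: v)]/= !shuffle_cons map_cat -!map_comp.
have /= -> := IHu (b :: v); have /= -> := IHv.
by rewrite -!map_comp.
Qed.

(** The shuffles that follow [u] up to the letter [k], and only then mix in [v].  The
    recursive form gives inductive proofs that parallel those on [shuffle];
    [nw_shuffleE] recovers the description by positions. *)
Fixpoint nw_shuffle (T : eqType) (k : T) u v : seq (seq T) :=
  if u is a :: u' then
    map (cons a) (if a == k then shuffle u' v else nw_shuffle k u' v)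
  else [::].

Lemma map_nw_shuffle (T T' : eqType) (f : T -> T') (k : T) u v :
  {in k :: u &, injective f} ->
  nw_shuffle (f k) (map f u) (map f v) = map (map f) (nw_shuffle k u v).
Proof.
elim: u => //= a u IHu f_inj.
rewrite (inj_in_eq f_inj) ?inE ?eqxx ?orbT //.
case: eqP => _; last first.
  rewrite IHu -?map_comp // => b c; rewrite !inE => bu cu.
  by apply: f_inj; rewrite !inE; [case/orP: bu | case/orP: cu] => ->; rewrite ?orbT.
by rewrite map_shuffle -!map_comp.
Qed.

Definition splits (T : Type) (w : seq T) : seq (seq T * seq T) :=
  [seq (take i w, drop i w) | i <- iota 0 (size w).+1].

Lemma map_splits (T T' : Type) (f : T -> T') w :
  splits (map f w) = [seq (map f p.1, map f p.2) | p <- splits w].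
Proof.
rewrite /splits size_map -map_comp; apply: eq_map => i /=.
by rewrite map_take map_drop.
Qed.

Section Shuffles.
Context (T : eqType).
Implicit Types (a b k l : T) (u v w x y z : seq T).

Lemma shuffle_perm u v w : w \in shuffle u v -> perm_eq w (u ++ v).
Proof.
elim: u v w => [|a u IHu] v w; first by rewrite inE => /eqP->.
elim: v w => [|b v IHv] w; first by rewrite inE cats0 => /eqP->.
rewrite shuffle_cons mem_cat => /orP[] /mapP[x /[swap] ->].
  by move=> /IHu; rewrite /= perm_cons.
move=> /IHv; rewrite -(perm_cons b) => /perm_trans->//.
by rewrite -[b :: _ ++ v]cat1s perm_catCA.
Qed.

Lemma shuffle_uniq u v : uniq (u ++ v) -> uniq (shuffle u v).
Proof.
elim: u v => [|a u IHu] //; elim=> [|b v IHv] // Uuv.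
have consI c : injective (cons c) by move=> x y [].
rewrite shuffle_cons cat_uniq !map_inj_uniq ?IHu ?IHv //=.
- rewrite andbT; apply/hasPn => _ /mapP[x _ ->]; apply/mapP => -[y _ [eq_ba _]].
  by move: Uuv; rewrite /= mem_cat inE eq_ba eqxx orbT.
- by move: Uuv; rewrite -[b :: v]cat1s uniq_catCA /= => /andP[].
- by case/andP: Uuv.
Qed.

(** A shuffle is determined by the positions of the letters of [u]; when a predicate
    [p] tells the letters of [u] from those of [v], these positions can be read off
    the word. *)
Lemma mem_shuffle (p : pred T) u v w : all p u -> all (predC p) v ->
  (w \in shuffle u v) = (filter p w == u) && (filter (predC p) w == v).
Proof.
have mem_filters x : x \in shuffle (filter p x) (filter (predC p) x).
  elim: x => //= c x; move: (filter p x) (filter (predC p) x) => y z sh_x.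
  case: (p c) => /=.
    case: z sh_x => [|d z]; first by rewrite !shuffle_nilr !inE => /eqP<-.
    by rewrite shuffle_cons mem_cat => sh_x; rewrite map_f.
  case: y sh_x => [|d y]; first by rewrite !inE => /eqP<-.
  by rewrite shuffle_cons mem_cat => sh_x; rewrite orbC map_f.
move=> pu pv; apply/idP/andP => [|[/eqP<- /eqP<-]] //.
elim: u v w pu pv => [|a u IHu] v w.
  rewrite inE => _ pv /eqP->; split; last exact/eqP/all_filterP.
  by apply/eqP; elim: v pv => //= b v IHv /andP[/negPf->].
move=> pu; elim: v w => [|b v IHv] w.
  rewrite inE => _ /eqP->; split; first exact/eqP/all_filterP.
  by apply/eqP; elim: (a :: u) pu => //= c x IHx /andP[->].
have /= /andP[pa pu'] := pu; move=> /= pv; have /andP[pb pv'] := pv.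
rewrite shuffle_cons mem_cat => /orP[] /mapP[x sh_x ->] /=.
  by have [/eqP-> /eqP->] := IHu (b :: v) x pu' pv sh_x; rewrite pa.
by have [/eqP-> /eqP->] := IHv _ pv' sh_x; rewrite (negPf pb).
Qed.

(** By induction on [u]: a shuffle starting with a letter of [v] fails the test, as
    [k] is still to come, and once [k] has been read every shuffle passes. *)
Lemma nw_shuffleE k u v : uniq (u ++ v) -> k \in u ->
  nw_shuffle k u v =
  [seq w <- shuffle u v | all (fun b => index k w < index b w)%N v].
Proof.
elim: u => //= a u IHu /andP[a_uv Uuv]; rewrite inE eq_sym.
case: v => [|b v] in IHu a_uv Uuv *.
  case: eqVneq => [_ _ | _ /= k_u]; first by rewrite shuffle_nilr.
  by rewrite IHu // shuffle_nilr.
have ->: [seq w <- shuffle (a :: u) (b :: v) |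
            all (fun c => index k w < index c w)%N (b :: v)] =
    map (cons a) [seq w <- shuffle u (b :: v) |
            all (fun c => index k (a :: w) < index c (a :: w))%N (b :: v)].
  rewrite shuffle_cons filter_cat -[RHS]cats0; congr (_ ++ _).
    by rewrite filter_map.
  rewrite filter_map -[RHS]/(map (cons b) [::]); congr map.
  by rewrite -(filter_pred0 (shuffle (a :: u) v)); apply: eq_filter => w /=;
     rewrite eqxx ltn0.
have neq_a c : c \in b :: v -> a == c = false.
  by move: a_uv; rewrite mem_cat negb_or => /andP[_ +]; case: eqVneq => // ->  /negPf->.
case: eqVneq => [eq_ak _ | neq_ak /= k_u]; congr map.
  rewrite -[LHS]filter_predT; apply: eq_filter => w; symmetry; apply/allP => c /neq_a.
  by rewrite /= eq_ak eqxx => ->.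
rewrite IHu //; apply: eq_filter => w; apply: eq_in_all => c /neq_a /= ->.
by rewrite (negPf neq_ak).
Qed.

Lemma splits_cons a w :
  splits (a :: w) = ([::], a :: w) :: [seq (a :: p.1, p.2) | p <- splits w].
Proof.
have iotaE n : iota 0 n.+1 = 0%N :: map S (iota 0 n) by rewrite -(iotaDl 1).
by rewrite /splits [size _]/= iotaE map_cons -!map_comp drop0 take0.
Qed.

Lemma mem_splits w p : (p \in splits w) = (p.1 ++ p.2 == w).
Proof.
apply/mapP/eqP => [[i _ ->]|<-]; first exact: cat_take_drop.
exists (size p.1); last by rewrite take_size_cat // drop_size_cat //; case: p.
by rewrite mem_iota size_cat; lia.
Qed.

Lemma splits_uniq w : uniq (splits w).
Proof.
rewrite map_inj_in_uniq ?iota_uniq // => i j; rewrite !mem_iota => lti ltj.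
by move=> [/(congr1 size) + _]; rewrite !size_takel //; lia.
Qed.

End Shuffles.

(** * Sums over shuffles and over cuts *)

Section WordSums.
Context (T : eqType) (V : nmodType).
Implicit Types (a b k l : T) (u v w x y z : seq T).
Implicit Types (F : seq T -> V) (G : seq T -> seq T -> V).

Lemma sum_shuffle_cons F a u b v :
  \sum_(w <- shuffle (a :: u) (b :: v)) F w =
  \sum_(w <- shuffle u (b :: v)) F (a :: w) +
  \sum_(w <- shuffle (a :: u) v) F (b :: w).
Proof. by rewrite shuffle_cons big_cat !big_map. Qed.

Lemma sum_nw_shuffle_cons F k a u v :
  \sum_(w <- nw_shuffle k (a :: u) v) F w =
  if a == k then \sum_(w <- shuffle u v) F (a :: w)
  else \sum_(w <- nw_shuffle k u v) F (a :: w).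
Proof. by rewrite [nw_shuffle k _ _]/= big_map; case: ifP. Qed.

Lemma sum_splits_cons G a w :
  \sum_(p <- splits (a :: w)) G p.1 p.2 =
  G [::] (a :: w) + \sum_(p <- splits w) G (a :: p.1) p.2.
Proof. by rewrite splits_cons big_cons big_map. Qed.

Lemma sum_splits_nil G : \sum_(p <- splits [::]) G p.1 p.2 = G [::] [::].
Proof. by rewrite /splits big_seq1. Qed.

Lemma sum_splits_prefix_nil w G :
  \sum_(p <- splits w) (if p.1 == [::] then G p.1 p.2 else 0) = G [::] w.
Proof.
case: w => [|a w]; first by rewrite (sum_splits_nil (fun x y => if x == [::] then G x y else 0)).
rewrite (sum_splits_cons (fun x y => if x == [::] then G x y else 0)) /=.
by rewrite big1 ?addr0.
Qed.

Lemma sum_splits_suffix_nil w G :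
  \sum_(p <- splits w) (if p.2 == [::] then G p.1 p.2 else 0) = G w [::].
Proof.
elim: w G => [|a w IHw] G.
  by rewrite (sum_splits_nil (fun x y => if y == [::] then G x y else 0)).
rewrite (sum_splits_cons (fun x y => if y == [::] then G x y else 0)) /= add0r.
by rewrite (IHw (fun x y => G (a :: x) y)).
Qed.

(** Both sides run over the factorizations of [w] into three words. *)
Lemma splits_coassoc (H : seq T -> seq T -> seq T -> V) w :
  \sum_(p <- splits w) \sum_(q <- splits p.1) H q.1 q.2 p.2 =
  \sum_(p <- splits w) \sum_(q <- splits p.2) H p.1 q.1 q.2.
Proof.
elim: w H => [|a w IHw] H; first by rewrite /splits !big_seq1.
rewrite (sum_splits_cons (fun x y => \sum_(q <- splits x) H q.1 q.2 y)).
rewrite (sum_splits_cons (fun x y => \sum_(q <- splits y) H x q.1 q.2)).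
rewrite (sum_splits_nil (fun x y => H x y _)) (sum_splits_cons (H _)) -addrA.
congr (_ + _); rewrite -(IHw (fun x y z => H (a :: x) y z)) -big_split.
by apply: eq_bigr => p _; rewrite (sum_splits_cons (fun x y => H x y _)).
Qed.

(** A cut of a shuffle cuts [u] and [v]: its prefix shuffles the two prefixes and its
    suffix the two suffixes. *)
Lemma splits_shuffle G u v :
  \sum_(w <- shuffle u v) \sum_(p <- splits w) G p.1 p.2 =
  \sum_(p <- splits u) \sum_(q <- splits v)
    \sum_(x <- shuffle p.1 q.1) \sum_(y <- shuffle p.2 q.2) G x y.
Proof.
elim: u v G => [|a u IHu] v.
  move=> G; rewrite /splits !big_seq1; apply: eq_bigr => q _.
  by rewrite !big_seq1.
elim: v => [|b v IHv] G.
  rewrite shuffle_nilr big_seq1; apply: eq_bigr => p _.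
  by rewrite /splits !big_seq1 !shuffle_nilr !big_seq1.
rewrite (sum_splits_cons (fun p1 p2 => \sum_(q <- splits (b :: v))
  \sum_(x <- shuffle p1 q.1) \sum_(y <- shuffle p2 q.2) G x y)).
rewrite (sum_splits_cons (fun q1 q2 =>
  \sum_(x <- shuffle [::] q1) \sum_(y <- shuffle (a :: u) q2) G x y)) big_seq1.
have -> : \sum_(w <- shuffle (a :: u) (b :: v)) \sum_(p <- splits w) G p.1 p.2 =
    \sum_(w <- shuffle (a :: u) (b :: v)) G [::] w +
    (\sum_(w <- shuffle u (b :: v)) \sum_(p <- splits w) G (a :: p.1) p.2 +
     \sum_(w <- shuffle (a :: u) v) \sum_(p <- splits w) G (b :: p.1) p.2).
  rewrite !sum_shuffle_cons addrACA -!big_split.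
  by congr (_ + _); apply: eq_bigr => w _; rewrite sum_splits_cons.
rewrite -addrA; congr (_ + _).
rewrite (IHu _ (fun x y => G (a :: x) y)) (IHv (fun x y => G (b :: x) y)).
rewrite (sum_splits_cons (fun p1 p2 => \sum_(q <- splits v)
  \sum_(x <- shuffle p1 q.1) \sum_(y <- shuffle p2 q.2) G (b :: x) y)).
rewrite addrCA; congr (_ + _).
  by apply: eq_bigr => q _; rewrite !big_seq1.
rewrite -big_split; apply: eq_bigr => p _ /=.
rewrite (sum_splits_cons (fun q1 q2 =>
  \sum_(x <- shuffle p.1 q1) \sum_(y <- shuffle p.2 q2) G (a :: x) y)).
rewrite (sum_splits_cons (fun q1 q2 =>
  \sum_(x <- shuffle (a :: p.1) q1) \sum_(y <- shuffle p.2 q2) G x y)).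
rewrite !shuffle_nilr !big_seq1 -addrA; congr (_ + _).
by rewrite -big_split; apply: eq_bigr => q _; rewrite sum_shuffle_cons.
Qed.

(** If the cut of [u] leaves [k] in the suffix, no letter of [v] has been met yet and
    the whole of [v] is in the suffix; otherwise the constraint only bears on the
    prefix, and the suffix is an ordinary shuffle. *)
Lemma splits_nw_shuffle G k u v : k \in u ->
  \sum_(w <- nw_shuffle k u v) \sum_(p <- splits w) G p.1 p.2 =
  \sum_(p <- splits u)
    if k \in p.1 then
      \sum_(q <- splits v)
        \sum_(x <- nw_shuffle k p.1 q.1) \sum_(y <- shuffle p.2 q.2) G x y
    else \sum_(y <- nw_shuffle k p.2 v) G p.1 y.
Proof.
elim: u G => // a u IHu G; rewrite inE eq_sym => k_u.
rewrite (sum_splits_cons (fun p1 p2 => if k \in p1 then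
      \sum_(q <- splits v)
        \sum_(x <- nw_shuffle k p1 q.1) \sum_(y <- shuffle p2 q.2) G x y
    else \sum_(y <- nw_shuffle k p2 v) G p1 y)) [k \in _]/= !sum_nw_shuffle_cons.
case: eqP k_u => [<- _ | neq_ak /= k_u].
  under eq_bigr => w _ do rewrite sum_splits_cons.
  rewrite big_split (splits_shuffle (fun x y => G (a :: x) y)); congr (_ + _).
  apply: eq_bigr => p _; rewrite inE eqxx; apply: eq_bigr => q _.
  by rewrite sum_nw_shuffle_cons eqxx.
under eq_bigr => w _ do rewrite sum_splits_cons.
rewrite big_split (IHu (fun x y => G (a :: x) y)) //; congr (_ + _).
apply: eq_bigr => p _; rewrite inE eq_sym (introF eqP neq_ak) /=.
case: ifP => // _; apply: eq_bigr => q _.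
by rewrite big_map.
Qed.

(** Both sides run over the shuffles of three words, sorted by their first letter. *)
Lemma shuffle_assoc F u v z :
  \sum_(w <- shuffle u v) \sum_(t <- shuffle w z) F t =
  \sum_(w <- shuffle v z) \sum_(t <- shuffle u w) F t.
Proof.
elim: u v z F => [|a u IHu] v z F.
  by rewrite big_seq1; apply: eq_bigr => w _; rewrite big_seq1.
elim: v z F => [|b v IHv] z F; first by rewrite shuffle_nilr !big_seq1.
elim: z F => [|c z IHz] F.
  by rewrite !shuffle_nilr !big_seq1; apply: eq_bigr => w _; rewrite shuffle_nilr big_seq1.
rewrite !sum_shuffle_cons; under eq_bigr => w _ do rewrite sum_shuffle_cons.
under [X in _ + X]eq_bigr => w _ do rewrite sum_shuffle_cons.
rewrite !big_split addrACA (IHu _ _ (fun t => F (a :: t))) (IHv _ (fun t => F (b :: t))).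
under [X in _ = X + _]eq_bigr => w _ do rewrite sum_shuffle_cons.
under [X in _ = _ + X]eq_bigr => w _ do rewrite sum_shuffle_cons.
rewrite !big_split [RHS]addrACA -(IHz (fun t => F (c :: t))) !sum_shuffle_cons.
by rewrite -!addrA.
Qed.

(** Once [l] has been read, the constraint disappears and [shuffle_assoc] concludes. *)
Lemma shuffle_nw_shuffle_assoc F l u v z : l \notin u -> l \in v ->
  \sum_(w <- shuffle u v) \sum_(t <- nw_shuffle l w z) F t =
  \sum_(w <- nw_shuffle l v z) \sum_(t <- shuffle u w) F t.
Proof.
elim: u v F => [|a u IHu] v F.
  by rewrite big_seq1 => _ _; apply: eq_bigr => w _; rewrite big_seq1.
move=> l_au; have [] := norP l_au; rewrite eq_sym => /negPf neq_al l_u.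
elim: v F => // b v IHv F; rewrite inE eq_sym => l_bv; rewrite sum_shuffle_cons.
under eq_bigr => w _ do rewrite sum_nw_shuffle_cons neq_al.
rewrite (IHu _ (fun t => F (a :: t))) // ?inE 1?eq_sym // !sum_nw_shuffle_cons.
under [X in _ + X]eq_bigr => w _ do rewrite sum_nw_shuffle_cons.
case: eqP l_bv => /= [_ _ | _ l_v].
  under [RHS]eq_bigr => w _ do rewrite sum_shuffle_cons.
  by rewrite big_split (shuffle_assoc (fun t => F (b :: t))).
under [RHS]eq_bigr => w _ do rewrite sum_shuffle_cons.
by rewrite big_split (IHv (fun t => F (b :: t))).
Qed.

Lemma nw_shuffle_assoc F k l u v z : l \notin u -> l \in v ->
  \sum_(w <- nw_shuffle k u v) \sum_(t <- nw_shuffle l w z) F t =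
  \sum_(w <- nw_shuffle l v z) \sum_(t <- nw_shuffle k u w) F t.
Proof.
move=> + l_v; elim: u F => [|a u IHu] F; first by rewrite big_nil big1 // => w _; rewrite big_nil.
rewrite inE => /norP[]; rewrite eq_sym => /negPf neq_al l_u.
rewrite sum_nw_shuffle_cons; under [RHS]eq_bigr => w _ do rewrite sum_nw_shuffle_cons.
case: ifP => _.
  under [LHS]eq_bigr => w _ do rewrite sum_nw_shuffle_cons neq_al.
  exact: (shuffle_nw_shuffle_assoc (fun t => F (a :: t))).
under [LHS]eq_bigr => w _ do rewrite sum_nw_shuffle_cons neq_al.
exact: (IHu (fun t => F (a :: t))).
Qed.

End WordSums.

(** The condition [P] is only tested on the prefix: this is how the position of the
    greatest letter enters the coproducts. *)
Lemma sum_splits_prefix_nil_cond (T : eqType) (V : nmodType) (P : pred (seq T))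
    (G : seq T -> seq T -> V) w :
  \sum_(p <- splits w | P p.1) (if p.1 == [::] then G p.1 p.2 else 0) =
  if P [::] then G [::] w else 0.
Proof.
rewrite big_mkcond -(sum_splits_prefix_nil w (fun x y => if P x then G x y else 0)).
by apply: eq_bigr => p _; case: ifP; case: ifP.
Qed.

Lemma sum_splits_suffix_nil_cond (T : eqType) (V : nmodType) (P : pred (seq T))
    (G : seq T -> seq T -> V) w :
  \sum_(p <- splits w | P p.1) (if p.2 == [::] then G p.1 p.2 else 0) =
  if P w then G w [::] else 0.
Proof.
rewrite big_mkcond -(sum_splits_suffix_nil w (fun x y => if P x then G x y else 0)).
by apply: eq_bigr => p _; case: ifP; case: ifP.
Qed.

Lemma sum_if0 (V : nmodType) I (r : seq I) (P : pred I) b (F : I -> V) :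
  \sum_(i <- r | P i) (if b then F i else 0) = if b then \sum_(i <- r | P i) F i else 0.
Proof. by case: b => //; rewrite big1. Qed.

Section Pieces.
Variables (V : nmodType) (T : eqType) (P Q : pred (seq T)) (u v : seq T).
Variable F : seq T -> seq T -> seq T -> seq T -> V.

(** In a double sum over the cuts of [u] and of [v], requiring one of the four pieces
    to be empty removes one of the two sums; there is one lemma for each piece. *)
Lemma sum2_prefix_nil_l :
  \sum_(p <- splits u | Q p.1) \sum_(q <- splits v | P q.1)
    (if p.1 == [::] then F p.1 p.2 q.1 q.2 else 0) =
  if Q [::] then \sum_(q <- splits v | P q.1) F [::] u q.1 q.2 else 0.
Proof.
under eq_bigr => p _ do rewrite sum_if0.
exact: (sum_splits_prefix_nil_cond Q
  (fun p1 p2 => \sum_(q <- splits v | P q.1) F p1 p2 q.1 q.2)).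
Qed.

Lemma sum2_suffix_nil_l :
  \sum_(p <- splits u | Q p.1) \sum_(q <- splits v | P q.1)
    (if p.2 == [::] then F p.1 p.2 q.1 q.2 else 0) =
  if Q u then \sum_(q <- splits v | P q.1) F u [::] q.1 q.2 else 0.
Proof.
under eq_bigr => p _ do rewrite sum_if0.
exact: (sum_splits_suffix_nil_cond Q
  (fun p1 p2 => \sum_(q <- splits v | P q.1) F p1 p2 q.1 q.2)).
Qed.

Lemma sum2_prefix_nil_r :
  \sum_(p <- splits u | Q p.1) \sum_(q <- splits v | P q.1)
    (if q.1 == [::] then F p.1 p.2 q.1 q.2 else 0) =
  if P [::] then \sum_(p <- splits u | Q p.1) F p.1 p.2 [::] v else 0.
Proof.
by rewrite -sum_if0; apply: eq_bigr => p _; rewrite (sum_splits_prefix_nil_cond P (F _ _)).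
Qed.

Lemma sum2_suffix_nil_r :
  \sum_(p <- splits u | Q p.1) \sum_(q <- splits v | P q.1)
    (if q.2 == [::] then F p.1 p.2 q.1 q.2 else 0) =
  if P v then \sum_(p <- splits u | Q p.1) F p.1 p.2 v [::] else 0.
Proof.
by rewrite -sum_if0; apply: eq_bigr => p _; rewrite (sum_splits_suffix_nil_cond P (F _ _)).
Qed.

End Pieces.

(** * Linear maps and tensors *)

Section Linearity.
Context (K : fieldType).
Implicit Types U V W : lmodType K.

Lemma linear_to0 U V (f : U -> V) : linear f -> f 0 = 0.
Proof. by move=> f_lin; have := f_lin (-1) 0 0; rewrite scaler0 addr0 scaleN1r addNr. Qed.

Lemma linear_to_sum U V (f : U -> V) (I : Type) (r : seq I) (P : pred I) F :
  linear f -> f (\sum_(i <- r | P i) F i) = \sum_(i <- r | P i) f (F i).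
Proof.
move=> f_lin; apply: big_morph; last exact: linear_to0.
by move=> x y; have := f_lin 1 x y; rewrite !scale1r.
Qed.

Lemma linear_id_fun U : linear (fun x : U => x).
Proof. by []. Qed.

Lemma linear_add U V (f g : U -> V) :
  linear f -> linear g -> linear (fun x => f x + g x).
Proof.
by move=> f_lin g_lin a x y; rewrite f_lin g_lin scalerDr addrACA.
Qed.

Lemma linear_comp U V W (f : V -> W) (g : U -> V) :
  linear f -> linear g -> linear (fun x => f (g x)).
Proof. by move=> f_lin g_lin a x y; rewrite g_lin f_lin. Qed.

Lemma tmul0l U V (T : tensor U V) (y : V) : 0 ⊗ y = 0 :> T.
Proof. by have [tl _] := tmul_bilinear T; apply: (linear_to0 (tl y)). Qed.

Lemma tmul0r U V (T : tensor U V) (x : U) : x ⊗ 0 = 0 :> T.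
Proof. by have [_ tr] := tmul_bilinear T; apply: (linear_to0 (tr x)). Qed.

Lemma linear_bil_l U V V' W (f : V -> V' -> W) v (g : U -> V) :
  bilinear_map f -> linear g -> linear (fun x => f (g x) v).
Proof. by case=> f_l _; apply: (@linear_comp _ _ _ (f^~ v)). Qed.

Lemma linear_bil_r U V V' W (f : V -> V' -> W) v (g : U -> V') :
  bilinear_map f -> linear g -> linear (fun x => f v (g x)).
Proof. by case=> _ f_r; apply: linear_comp. Qed.

Lemma malg_linear_ext (B : choiceType) W (f g : {malg K[B]} -> W) :
  linear f -> linear g -> (forall b, f << b >> = g << b >>) -> f =1 g.
Proof.
move=> f_lin g_lin eq_fg x; rewrite [x]malg_linextE !linear_linext //.
by apply: eq_bigr => b _; rewrite eq_fg.
Qed.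

End Linearity.

(** Two linear maps on a tensor product agree as soon as they agree on pure tensors. *)
Lemma tlift_fun_linear (K : fieldType) (U V X W : lmodType K) (T : tensor U V)
    (F : X -> U -> V -> W) t :
  (forall x, bilinear_map (F x)) -> (forall u v, linear (fun x => F x u v)) ->
  linear (fun x => tlift T (F x) t).
Proof.
move=> F_bil F_lin a x y.
apply: (tensor_ext (t := T) (g := tlift T (F (a *: x + y)))
  (h := fun t => a *: tlift T (F x) t + tlift T (F y) t)) => [||u v].
- exact: tlift_linear.
- move=> b u v; rewrite !(tlift_linear (F_bil _)) !scalerDr !scalerA mulrC.
  by rewrite addrACA.
by rewrite !(tlift_tmul T (F_bil _)) F_lin.
Qed.

Lemma tlift_arg_linear (K : fieldType) (U V X W : lmodType K) (T : tensor U V)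
    (F : U -> V -> W) (D : X -> T) :
  bilinear_map F -> linear D -> linear (fun x => tlift T F (D x)).
Proof. by move=> F_bil; apply: linear_comp; apply: tlift_linear. Qed.

(** * Words with a greatest letter *)

(** The greatest letter is given as an argument, rather than computed, because a factor
    of a word keeps the same greatest letter whenever it contains it. *)
Definition is_top m (w : seq nat) := (m \in w) && all (leq^~ m) w.

Lemma ex_top w : w != [::] -> exists m, is_top m w.
Proof.
elim: w => // a w IHw _; case: w IHw => [_ | b w /(_ isT)[m /andP[m_w m_top]]].
  by exists a; rewrite /is_top inE eqxx /= leqnn.
have [le_am | lt_ma] := leqP a m.
  by exists m; rewrite /is_top inE m_w orbT /= le_am.
exists a; rewrite /is_top inE eqxx /= leqnn /=.
by apply: sub_all m_top => c /leq_trans->//; apply: ltnW.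
Qed.

Lemma top_nonempty m w : is_top m w -> w != [::].
Proof. by case: w. Qed.

Lemma splits_sub (T : eqType) (w : seq T) p : uniq w -> p \in splits w ->
  [/\ uniq p.1, uniq p.2, {subset p.1 <= w} & {subset p.2 <= w}].
Proof.
move=> + /[!mem_splits]/eqP def_w; rewrite -def_w cat_uniq => /and3P[U1 _ U2].
by split=> // x; rewrite mem_cat => ->; rewrite ?orbT.
Qed.

Lemma top_cat_l m w p : is_top m w -> p \in splits w -> m \in p.1 -> is_top m p.1.
Proof.
move=> /andP[_ w_m] /[!mem_splits] /eqP def_w m_p; rewrite /is_top m_p.
by move: w_m; rewrite -def_w all_cat => /andP[].
Qed.

Lemma top_cat_r m w p : is_top m w -> p \in splits w -> m \notin p.1 -> is_top m p.2.
Proof.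
move=> /andP[m_w w_m] /[!mem_splits] /eqP def_w m_p; move: m_w w_m.
by rewrite -def_w mem_cat (negPf m_p) all_cat /is_top /= => -> /andP[].
Qed.

(** Stated as a sum of booleans so that the position of [m] among three factors is
    settled by case analysis. *)
Lemma mem_cat3_uniq (m : nat) a b c : uniq (a ++ b ++ c) -> m \in a ++ b ++ c ->
  ((m \in a) + (m \in b) + (m \in c))%N = 1%N.
Proof.
move=> U m_w; have := count_uniq_mem m U; rewrite m_w !count_cat addnA.
move: U; rewrite !cat_uniq => /and3P[Ua _ /and3P[Ub _ Uc]].
by rewrite !count_uniq_mem.
Qed.

Lemma nw_shuffle_sub (T : eqType) (k : T) x y w :
  uniq (x ++ y) -> k \in x -> w \in nw_shuffle k x y -> w \in shuffle x y.
Proof. by move=> Uxy k_x; rewrite nw_shuffleE // mem_filter => /andP[]. Qed.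

Lemma allrel_ltn_uniq (u v : seq nat) :
  uniq u -> uniq v -> allrel ltn u v -> uniq (u ++ v).
Proof.
move=> Uu Uv /allrelP lt_uv; rewrite cat_uniq Uu Uv andbT /=.
by apply/hasPn => c c_v; apply/negP => c_u; have := lt_uv c c c_u c_v; rewrite /= ltnn.
Qed.

Lemma allrel_ltn_notin m (u v : seq nat) : allrel ltn u v -> m \in v -> m \notin u.
Proof.
move=> /allrelP lt_uv m_v; apply/negP => m_u.
by have := lt_uv m m m_u m_v; rewrite /= ltnn.
Qed.

Lemma allrel_sub (u v u' v' : seq nat) :
  {subset u' <= u} -> {subset v' <= v} -> allrel ltn u v -> allrel ltn u' v'.
Proof.
by move=> sub_u sub_v /allrelP lt_uv; apply/allrelP => x y /sub_u x_u /sub_v; apply: lt_uv.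
Qed.

Lemma perm_cat_allrel_l (w u v z : seq nat) : perm_eq w (u ++ v) ->
  allrel ltn u z -> allrel ltn v z -> allrel ltn w z.
Proof.
by move=> w_uv u_z v_z; rewrite (eq_allrel_meml _ _ (perm_mem w_uv)) allrel_catl u_z.
Qed.

Lemma perm_cat_allrel_r (w u v z : seq nat) : perm_eq w (u ++ v) ->
  allrel ltn z u -> allrel ltn z v -> allrel ltn z w.
Proof.
by move=> w_uv z_u z_v; rewrite (eq_allrel_memr _ _ (perm_mem w_uv)) allrel_catr z_u.
Qed.

Lemma top_allrel m u v : is_top m u -> all (ltn m) v -> allrel ltn u v.
Proof.
move=> /andP[_ /allP u_m] /allP m_v; apply/allrelP => x y /u_m x_m /m_v.
exact: leq_ltn_trans.
Qed.

Lemma allrel_top m u v : allrel ltn u v -> is_top m v -> all (leq^~ m) u.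
Proof.
move=> /allrelP lt_uv /andP[m_v _]; apply/allP => x x_u.
exact/ltnW/lt_uv.
Qed.

Lemma top_shuffle m u v w : is_top m v -> all (leq^~ m) u -> w \in shuffle u v -> is_top m w.
Proof.
move=> /andP[m_v v_m] u_m /shuffle_perm w_uv.
by rewrite /is_top (perm_mem w_uv) (perm_all _ w_uv) mem_cat m_v orbT all_cat u_m.
Qed.

(** * Standardized words as vectors *)

Section WordVectors.
Context (K : fieldType).
Local Notation A := (FQSym K).
Local Notation AA := (FQSym2 K).

Definition fq_word (w : seq nat) : A := fq_elt K (std w).

Lemma fq_word_nil : fq_word [::] = 0.
Proof. by []. Qed.

Lemma size_word n (s : 'S_n) : size (word s) = n.
Proof. by rewrite size_map size_enum_ord. Qed.

Lemma word_inj n : injective (@word n).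
Proof.
move=> s t /eq_in_map eq_st; apply/permP => i; apply: val_inj.
by have [] := eq_st i (mem_enum _ i).
Qed.

Lemma word_perm_iota n (s : 'S_n) : perm_eq (word s) (iota 1 n).
Proof.
apply: uniq_perm; last move=> i.
- by rewrite map_inj_uniq ?enum_uniq // => i j [] /val_inj/perm_inj.
- exact: iota_uniq.
rewrite mem_iota; apply/mapP/idP => [[j _ ->] | /andP[i_gt0 i_le]].
  by rewrite /= add1n ltnS.
have lt_i : (i.-1 < n)%N by lia.
exists (s^-1%g (Ordinal lt_i)); first exact: mem_enum.
by rewrite permKV /=; lia.
Qed.

Lemma word_uniq n (s : 'S_n) : uniq (word s).
Proof. by rewrite (perm_uniq (word_perm_iota s)) iota_uniq. Qed.

(** The word determines the size of the permutation, so that elements of different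
    [fq_elt] types can be compared. *)
Lemma fq_elt_word m n (s : 'S_m) (t : 'S_n) :
  word s = word t -> fq_elt K s = fq_elt K t.
Proof.
move=> eq_st; have eq_mn : m = n by rewrite -(size_word s) eq_st size_word.
by case: _ / eq_mn in t eq_st *; rewrite (word_inj eq_st).
Qed.

(** The standardization of a word replaces each letter by its rank. *)
Definition rank (w : seq nat) (c : nat) : nat := (count (ltn^~ c) w).+1.

(** For distinct letters, the tie-breaking rule of [std_lt] never applies. *)
Lemma word_std w : uniq w -> word (std w) = map (rank w) w.
Proof.
move=> w_uniq; have def_w : w = [seq nth 0%N w i | i : 'I_(size w)].
  by rewrite /image_mem (map_comp (nth 0%N w) val) val_enum_ord map_nth_iota0 ?take_size.
rewrite [in RHS]def_w -map_comp; apply: eq_map => i /=.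
rewrite permE /= /rank; congr _.+1; rewrite cardsE cardE size_filter -enumT.
transitivity (count (ltn^~ (nth 0%N w i)) [seq nth 0%N w j | j : 'I_(size w)]).
  rewrite [RHS]count_map; apply: eq_count => j.
  rewrite /= -topredE /= /std_lt; case: ltngtP => //= /eqP.
  by rewrite nth_uniq // => /eqP ->; rewrite ltnn.
by rewrite -def_w.
Qed.

Lemma rank_perm u v : perm_eq u v -> rank u =1 rank v.
Proof. by move=> /seq.permP eq_uv c; rewrite /rank eq_uv. Qed.

Lemma rank_mono w : {in w &, {mono rank w : x y / (x < y)%N}}.
Proof.
have homo_rank x y : x \in w -> (x < y)%N -> (rank w x < rank w y)%N.
  move=> x_w lt_xy; rewrite ltnS.
  have: (count (ltn^~ x) w + count_mem x w <= count (ltn^~ y) w)%N.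
    by elim: w {x_w} => //= c w IHw; lia.
  by apply: leq_trans; rewrite -[X in (X < _)%N]addn0 ltn_add2l -has_count has_pred1.
move=> x y x_w y_w; apply/idP/idP; last exact: homo_rank.
apply: contraLR; rewrite -!leqNgt leq_eqVlt => /orP[/eqP-> // | lt_yx].
by rewrite ltnW ?homo_rank.
Qed.

Lemma mono_ltn_inj (w : seq nat) f :
  {in w &, {mono f : x y / (x < y)%N}} -> {in w &, injective f}.
Proof.
move=> f_mono x y x_w y_w eq_f; case: (ltngtP x y) => // lt_xy.
  by have := f_mono x y x_w y_w; rewrite eq_f ltnn lt_xy.
by have := f_mono y x y_w x_w; rewrite eq_f ltnn lt_xy.
Qed.

(** An order-preserving relabelling of the letters does not change their ranks. *)
Lemma fq_word_map f w : uniq w -> {in w &, {mono f : x y / (x < y)%N}} ->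
  fq_word (map f w) = fq_word w.
Proof.
move=> w_uniq f_mono; apply: fq_elt_word.
have fw_uniq : uniq (map f w) by rewrite map_inj_in_uniq //; apply: mono_ltn_inj.
rewrite !word_std // -map_comp; apply/eq_in_map => x x_w.
rewrite /= /rank count_map; congr _.+1; apply: eq_in_count => y y_w /=.
exact: f_mono.
Qed.

Lemma map_rank_perm_iota n w : perm_eq w (iota 1 n) -> map (rank w) w = w.
Proof.
move=> w_perm; apply: map_id_in => x.
rewrite (rank_perm w_perm) (perm_mem w_perm) mem_iota /rank => /andP[x_gt0 x_le].
have ->: n = (x.-1 + (n - x.-1))%N by lia.
rewrite iotaD count_cat.
have /eqP -> : count (ltn^~ x) (iota 1 x.-1) == size (iota 1 x.-1).
  by rewrite -all_count; apply/allP => y; rewrite mem_iota /=; lia.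
have /eqP -> : count (ltn^~ x) (iota (1 + x.-1) (n - x.-1)) == 0%N.
  by rewrite -leqn0 leqNgt -has_count; apply/hasPn => y; rewrite mem_iota /=; lia.
by rewrite size_iota addn0 prednK.
Qed.

Lemma fq_word_word n (s : 'S_n) : fq_word (word s) = fq_elt K s.
Proof.
apply: fq_elt_word; rewrite word_std ?word_uniq //.
exact: map_rank_perm_iota (word_perm_iota s).
Qed.

Lemma wordP n (w : seq nat) : perm_eq w (iota 1 n) -> exists s : 'S_n, word s = w.
Proof.
move=> w_perm; have size_w : n = size w by rewrite (perm_size w_perm) size_iota.
have w_uniq : uniq w by rewrite (perm_uniq w_perm) iota_uniq.
subst n; exists (std w); rewrite word_std //.
exact: map_rank_perm_iota w_perm.
Qed.

Lemma fq_wordP w : w != [::] -> exists b : fq_basis,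
  [/\ fq_word w = << b >>, (tag b).+1 = size w & word (tagged b) = word (std w)].
Proof.
rewrite -size_eq0 /fq_word; case: {w}(size w) (std w) => // n s _.
by exists (Tagged (fun n => 'S_n.+1) s).
Qed.

End WordVectors.

(** * Products and coproducts of words *)

Section WordFormulas.
Context (K : fieldType).
Local Notation A := (FQSym K).
Local Notation AA := (FQSym2 K).
Local Notation wd := (fq_word K).

Local Notation "x ** y" := (ddmul (FQSym_ops K) x y) (at level 40).
Local Notation "x ^^ y" := (ddnw (FQSym_ops K) x y) (at level 40).
Local Notation prec := (ddprec (FQSym_ops K)).
Local Notation succ := (ddsucc (FQSym_ops K)).

(** The vectors of a sum over permutations, selected by their words, can be listed by
    the words themselves. *)
Lemma sum_perm_words n (s : seq (seq nat)) :
  uniq s -> (forall w, w \in s -> perm_eq w (iota 1 n)) ->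
  \sum_(r : 'S_n | word r \in s) fq_elt K r = \sum_(w <- s) wd w.
Proof.
move=> s_uniq s_perm.
have perm_s : perm_eq s [seq word r | r <- index_enum 'S_n & word r \in s].
  apply: uniq_perm => // [|w].
    by rewrite map_inj_uniq ?filter_uniq ?index_enum_uniq //; apply: word_inj.
  apply/idP/mapP => [w_s | [r + ->]]; last by rewrite mem_filter => /andP[].
  have [r def_w] := wordP (s_perm _ w_s).
  by exists r; rewrite // mem_filter def_w w_s mem_index_enum.
rewrite (perm_big _ perm_s) big_map big_filter.
by apply: eq_bigr => r _; rewrite fq_word_word.
Qed.

(** The letters of [v], being greater, do not affect the ranks of those of [u]. *)
Lemma word_std_catl (u v : seq nat) : uniq u -> allrel ltn u v ->
  word (std u) = map (rank (u ++ v)) u.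
Proof.
move=> Uu /allrelP lt_uv; rewrite word_std //; apply/eq_in_map => c c_u.
rewrite /rank count_cat; have /eqP -> : count (ltn^~ c) v == 0%N; last by rewrite addn0.
rewrite -leqn0 leqNgt -has_count; apply/hasPn => d d_v.
by rewrite -leqNgt ltnW //; apply: lt_uv.
Qed.

(** The letters of [u], being smaller, raise the ranks of those of [v] by [size u].
    With [word_std_catl], the words shuffled in the definition of the products are
    the images of [u] and [v] under one and the same increasing map. *)
Lemma word_std_catr (u v : seq nat) : uniq v -> allrel ltn u v ->
  shift (size u) (word (std v)) = map (rank (u ++ v)) v.
Proof.
move=> Uu /allrelP lt_uv; rewrite word_std // /shift -map_comp.
apply/eq_in_map => c c_v; rewrite /rank count_cat /= addnS.
have /eqP -> // : count (ltn^~ c) u == size u.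
by rewrite -all_count; apply/allP => d d_u; apply: lt_uv.
Qed.

Lemma perm_map_rank w : uniq w -> perm_eq (map (rank w) w) (iota 1 (size w)).
Proof. by move=> Uw; rewrite -word_std // word_perm_iota. Qed.

Lemma sum_fq_word_map_rank w s : uniq w -> (forall x, x \in s -> perm_eq x w) ->
  \sum_(x <- map (map (rank w)) s) wd x = \sum_(x <- s) wd x.
Proof.
move=> Uw s_perm; rewrite big_map; apply: eq_big_seq => x x_s.
have x_w := s_perm x x_s; rewrite fq_word_map ?(perm_uniq x_w) // => a b.
by rewrite !(perm_mem x_w); apply: rank_mono.
Qed.

Lemma rank_top m w : uniq w -> is_top m w -> rank w m = size w.
Proof.
move=> Uw /andP[m_w m_top]; rewrite /rank -addn1.
have -> : 1%N = count_mem m w by rewrite count_uniq_mem // m_w.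
by elim: w m_top {Uw m_w} => //= c w IHw /andP[? /IHw <-]; lia.
Qed.

Section Products.
Variables u v : seq nat.
Hypotheses (Uu : uniq u) (Uv : uniq v) (lt_uv : allrel ltn u v).

Let Uuv := allrel_ltn_uniq Uu Uv lt_uv.

Lemma mul_fq_word : u != [::] -> v != [::] ->
  wd u ** wd v = \sum_(w <- shuffle u v) wd w.
Proof.
move=> /(fq_wordP K)[s [-> size_s word_s]] /(fq_wordP K)[t [-> size_t word_t]].
have {}word_t : shift (tag s).+1 (word (tagged t)) = map (rank (u ++ v)) v.
  by rewrite size_s word_t word_std_catr.
rewrite (word_std_catl Uu lt_uv) in word_s.
rewrite /ddmul /= bilinextU /fq_mulb word_s word_t.
have Uf : uniq (map (rank (u ++ v)) u ++ map (rank (u ++ v)) v).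
  by rewrite -map_cat (perm_uniq (perm_map_rank Uuv)) iota_uniq.
rewrite sum_perm_words; first 1 last.
- exact: shuffle_uniq.
- move=> w /shuffle_perm/perm_trans->//; rewrite size_s size_t -size_cat -map_cat.
  exact: perm_map_rank.
by rewrite map_shuffle sum_fq_word_map_rank // => x /shuffle_perm.
Qed.

Lemma nw_fq_word m : is_top m u -> v != [::] ->
  wd u ^^ wd v = \sum_(w <- nw_shuffle m u v) wd w.
Proof.
move=> /andP[m_u /allP m_top].
have: u != [::] by apply: contraTneq m_u => ->.
move=> /(fq_wordP K)[s [-> size_s word_s]] /(fq_wordP K)[t [-> size_t word_t]].
have {}word_t : shift (tag s).+1 (word (tagged t)) = map (rank (u ++ v)) v.
  by rewrite size_s word_t word_std_catr.
rewrite (word_std_catl Uu lt_uv) in word_s.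
rewrite /ddnw /= bilinextU /fq_nwb word_s word_t.
have Uf : uniq (map (rank (u ++ v)) u ++ map (rank (u ++ v)) v).
  by rewrite -map_cat (perm_uniq (perm_map_rank Uuv)) iota_uniq.
have rank_m : rank (u ++ v) m = size u.
  rewrite -(@rank_top m u Uu _) ?/is_top ?m_u //; last exact/allP.
  have: map (rank (u ++ v)) u = map (rank u) u by rewrite -(word_std_catl Uu lt_uv) word_std.
  by move/eq_in_map/(_ m m_u).
(* The greatest letter of the standardized u is its length. *)
rewrite size_s -rank_m.
rewrite (eq_bigl (fun r => word r \in nw_shuffle (rank (u ++ v) m)
  (map (rank (u ++ v)) u) (map (rank (u ++ v)) v))); last first.
  by move=> r; rewrite nw_shuffleE ?map_f // mem_filter andbC.
rewrite sum_perm_words; first 1 last.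
- by rewrite nw_shuffleE ?filter_uniq ?shuffle_uniq // map_f.
- move=> w /(nw_shuffle_sub Uf (map_f _ m_u))/shuffle_perm/perm_trans->//.
  by rewrite rank_m size_t -size_cat -map_cat; apply: perm_map_rank.
rewrite map_nw_shuffle ?sum_fq_word_map_rank // => [x|].
  by move/(nw_shuffle_sub Uuv m_u)/shuffle_perm.
have ranki := mono_ltn_inj (@rank_mono (u ++ v)).
have sub_uv : {subset m :: u <= u ++ v}.
  by move=> x; rewrite inE mem_cat => /predU1P[->|->] //; rewrite m_u.
by move=> x y /sub_uv x_uv /sub_uv y_uv; apply: ranki.
Qed.

End Products.

Section Coproducts.

(** [(tag s).+1] is the greatest letter of the word, and [fq_max s] its position. *)
Lemma mem_take_word (s : fq_basis) i :
  ((tag s).+1 \in take i (word (tagged s))) = (fq_max s <= i)%N.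
Proof.
have F_inj : injective (fun j => (tagged s j).+1) by move=> j k [] /val_inj/perm_inj.
have [j def_max] : exists j, tagged s j = ord_max.
  by exists ((tagged s)^-1%g ord_max); rewrite permKV.
transitivity ((tagged s j).+1 \in take i (word (tagged s))); first by rewrite def_max.
rewrite in_take; last exact/map_f/mem_enum.
by rewrite (index_map F_inj) index_enum_ord /fq_max -def_max permK.
Qed.

(** The two trivial cuts, absent from the right-hand side, have an empty piece and
    contribute zero. *)
Lemma sum_splits_word (s : fq_basis) (P : pred (seq nat)) :
  \sum_(p <- splits (word (tagged s)) | P p.1) (wd p.1 ⊗ wd p.2 : AA) =
  \sum_(1 <= i < (tag s).+1 | P (take i (word (tagged s)))) fq_cut K s i.
Proof.
rewrite /splits big_map size_word -/(index_iota 0 (tag s).+2) big_mkcond.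
rewrite big_nat_recr // big_ltn // -big_mkcond take0.
rewrite [LHS](_ : _ =
  (if P [::] then wd [::] ⊗ wd (drop 0 (word (tagged s))) else 0) +
  \sum_(1 <= i < (tag s).+1 | P (take i (word (tagged s)))) fq_cut K s i +
  (if P (take (tag s).+1 (word (tagged s))) then
   wd (take (tag s).+1 (word (tagged s))) ⊗ wd (drop (tag s).+1 (word (tagged s))) else 0)) //.
rewrite (@drop_oversize _ (tag s).+1) ?size_word // !fq_word_nil.
by rewrite tmul0r tmul0l !if_same add0r addr0.
Qed.

Lemma prec_basis (s : fq_basis) :
  fq_precb K s = \sum_(p <- splits (word (tagged s)) | (tag s).+1 \in p.1)
    (wd p.1 ⊗ wd p.2).
Proof.
rewrite (sum_splits_word s (fun x => (tag s).+1 \in x)) /fq_precb (@big_nat_widenl _ _ _ _ 1) //.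
by apply: eq_bigl => i /=; rewrite mem_take_word.
Qed.

Lemma succ_basis (s : fq_basis) :
  fq_succb K s = \sum_(p <- splits (word (tagged s)) | (tag s).+1 \notin p.1)
    (wd p.1 ⊗ wd p.2).
Proof.
rewrite (sum_splits_word s (fun x => (tag s).+1 \notin x)) /fq_succb.
rewrite (big_nat_widen _ _ (tag s).+1) ?ltn_ord //.
by apply: eq_bigl => i /=; rewrite mem_take_word ltnNge.
Qed.

Lemma sum_splits_std m w (P : pred bool) : uniq w -> is_top m w ->
  \sum_(p <- splits (word (std w)) | P (size w \in p.1)) (wd p.1 ⊗ wd p.2) =
  \sum_(p <- splits w | P (m \in p.1)) (wd p.1 ⊗ wd p.2) :> AA.
Proof.
move=> Uw m_top; rewrite word_std // map_splits big_map /=.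
have rank_inj := mono_ltn_inj (@rank_mono w).
rewrite -(rank_top Uw m_top).
have [m_w _] := andP m_top.
rewrite [LHS]big_mkcond [RHS]big_mkcond; apply: eq_big_seq => p.
move=> /(splits_sub Uw)[U1 U2 sub1 sub2] /=.
have -> : (rank w m \in map (rank w) p.1) = (m \in p.1).
  apply/mapP/idP => [[x x_p] | m_p]; last by exists m.
  by move/rank_inj => -> //; apply: sub1.
rewrite !fq_word_map // => x y.
  by move=> /sub2 x_w /sub2 y_w; apply: rank_mono.
by move=> /sub1 x_w /sub1 y_w; apply: rank_mono.
Qed.

Lemma prec_fq_word m w : uniq w -> is_top m w ->
  prec (wd w) = \sum_(p <- splits w | m \in p.1) (wd p.1 ⊗ wd p.2).
Proof.
move=> Uw m_top; have : w != [::] by case/andP: m_top; case: w {Uw}.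
move=> /(fq_wordP K)[s [-> size_s word_s]]; rewrite /ddprec /= linextU prec_basis word_s size_s.
exact: (sum_splits_std id Uw m_top).
Qed.

Lemma succ_fq_word m w : uniq w -> is_top m w ->
  succ (wd w) = \sum_(p <- splits w | m \notin p.1) (wd p.1 ⊗ wd p.2).
Proof.
move=> Uw m_top; have : w != [::] by case/andP: m_top; case: w {Uw}.
move=> /(fq_wordP K)[s [-> size_s word_s]]; rewrite /ddsucc /= linextU succ_basis word_s size_s.
exact: (sum_splits_std negb Uw m_top).
Qed.

End Coproducts.

End WordFormulas.

(** Each basis vector is also the vector of a word whose letters all exceed [n].  In a
    law with several arguments, the words for the successive arguments can thus be
    taken on increasing alphabets, as the product formulas require. *)
Lemma word_ext (K : fieldType) (n : nat) (W : lmodType K) (f g : FQSym K -> W) :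
  linear f -> linear g ->
  (forall v, uniq v -> v != [::] -> all (ltn n) v -> f (fq_word K v) = g (fq_word K v)) ->
  f =1 g.
Proof.
move=> f_lin g_lin eq_fg; apply: malg_linear_ext => // s.
have -> : << s >> = fq_word K (shift n (word (tagged s))).
  rewrite fq_word_map ?word_uniq ?fq_word_word //; last by move=> x y _ _; rewrite ltn_add2l.
  by case: s.
have s_perm := word_perm_iota (tagged s).
rewrite /shift; apply: eq_fg.
- by rewrite map_inj_uniq ?word_uniq //; apply: addnI.
- by rewrite -size_eq0 size_map size_word.
- by rewrite all_map (perm_all _ s_perm); apply/allP => x; rewrite mem_iota /=; lia.
Qed.

(** * The Dup-Dend laws from the word formulas *)

Section DupDendOfWords.
Context (K : fieldType) (A : lmodType K) (AA : tensor A A) (AAA : tensor A AA).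
Context (O : dupdend_ops AA) (wd : seq nat -> A).

Local Notation mul := (ddmul O).
Local Notation nw := (ddnw O).
Local Notation prec := (ddprec O).
Local Notation succ := (ddsucc O).
Local Notation tilde := (ddtilde O).

Hypotheses (mul_bil : bilinear_map mul) (nw_bil : bilinear_map nw).
Hypotheses (prec_lin : linear prec) (succ_lin : linear succ).
Hypothesis word_ext : forall n (W : lmodType K) (f g : A -> W),
  linear f -> linear g ->
  (forall v, uniq v -> v != [::] -> all (ltn n) v -> f (wd v) = g (wd v)) ->
  f =1 g.
Hypothesis wd_nil : wd [::] = 0.
Hypothesis mul_wd : forall u v, uniq u -> uniq v -> allrel ltn u v ->
  u != [::] -> v != [::] -> mul (wd u) (wd v) = \sum_(w <- shuffle u v) wd w.
Hypothesis nw_wd : forall m u v, uniq u -> uniq v -> allrel ltn u v ->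
  is_top m u -> v != [::] -> nw (wd u) (wd v) = \sum_(w <- nw_shuffle m u v) wd w.
Hypothesis prec_wd : forall m w, uniq w -> is_top m w ->
  prec (wd w) = \sum_(p <- splits w | m \in p.1) (wd p.1 ⊗ wd p.2).
Hypothesis succ_wd : forall m w, uniq w -> is_top m w ->
  succ (wd w) = \sum_(p <- splits w | m \notin p.1) (wd p.1 ⊗ wd p.2).

Lemma tilde_wd m w : uniq w -> is_top m w ->
  tilde (wd w) = \sum_(p <- splits w) (wd p.1 ⊗ wd p.2).
Proof.
move=> Uw m_top; rewrite /ddtilde (prec_wd Uw m_top) (succ_wd Uw m_top).
by rewrite [RHS](bigID (fun p => m \in p.1)).
Qed.

Let tmul2_bil := tmul_bilinear AA.
Let tmul3_bil := tmul_bilinear AAA.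

Lemma tilde_lin : linear tilde.
Proof. exact: linear_add prec_lin succ_lin. Qed.

(** Linearity and bilinearity, from the head of the expression; the last cases are the
    eta-reduced forms that unification leaves. *)
Ltac lin :=
  cbv beta; lazymatch goal with
  | |- bilinear_map _ => split=> ?; lin
  | |- forall _, _ => move=> ?; lin
  | |- GRing.linear_for _ (fun x => x) => exact: linear_id_fun
  | |- GRing.linear_for _ (fun x => (_ + _)%R) => apply: linear_add; lin
  | |- GRing.linear_for _ (fun x => tlift _ _ _) =>
      first [apply: tlift_arg_linear | apply: tlift_fun_linear]; lin
  | |- GRing.linear_for _ (fun x => @tmul _ _ _ AA _ _) =>
      first [apply: (linear_bil_l _ tmul2_bil) | apply: (linear_bil_r _ tmul2_bil)]; lin
  | |- GRing.linear_for _ (fun x => @tmul _ _ _ AAA _ _) =>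
      first [apply: (linear_bil_l _ tmul3_bil) | apply: (linear_bil_r _ tmul3_bil)]; lin
  | |- GRing.linear_for _ (fun x => ddmul _ _ _) =>
      first [apply: (linear_bil_l _ mul_bil) | apply: (linear_bil_r _ mul_bil)]; lin
  | |- GRing.linear_for _ (fun x => ddnw _ _ _) =>
      first [apply: (linear_bil_l _ nw_bil) | apply: (linear_bil_r _ nw_bil)]; lin
  | |- GRing.linear_for _ (fun x => ddprec _ _) => apply: (linear_comp prec_lin); lin
  | |- GRing.linear_for _ (fun x => ddsucc _ _) => apply: (linear_comp succ_lin); lin
  | |- GRing.linear_for _ (fun x => ddtilde _ _) => apply: (linear_comp tilde_lin); lin
  | |- GRing.linear_for _ (tmul ?u) => exact: (tmul_bilinear _).2
  | |- GRing.linear_for _ (ddmul _ ?u) => exact: mul_bil.2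
  | |- GRing.linear_for _ (ddnw _ ?u) => exact: nw_bil.2
  | |- GRing.linear_for _ (tlift _ ?F) => apply: tlift_linear; lin
  | |- GRing.linear_for _ (ddprec _) => exact: prec_lin
  | |- GRing.linear_for _ (ddsucc _) => exact: succ_lin
  | |- GRing.linear_for _ (ddtilde _) => exact: tilde_lin
  | D_lin : GRing.linear_for _ ?D |- GRing.linear_for _ (fun x => ?D _) =>
      apply: (linear_comp D_lin); lin
  | D_lin : GRing.linear_for _ ?D |- GRing.linear_for _ ?D => exact: D_lin
  end.

Lemma mul0l y : mul 0 y = 0. Proof. exact: linear_to0 (mul_bil.1 y). Qed.
Lemma mul0r x : mul x 0 = 0. Proof. exact: linear_to0 (mul_bil.2 x). Qed.
Lemma nw0l y : nw 0 y = 0. Proof. exact: linear_to0 (nw_bil.1 y). Qed.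
Lemma nw0r x : nw x 0 = 0. Proof. exact: linear_to0 (nw_bil.2 x). Qed.

Definition zero_simp := (wd_nil, @tmul0l _ _ _ AA, @tmul0r _ _ _ AA,
  mul0l, mul0r, nw0l, nw0r,
  @addr0 A, @add0r A, @addr0 AA, @add0r AA).

(** The product formula extends to empty words at the price of two corrective terms,
    since the empty word gives the zero vector and not a unit.  These terms are the
    source of the isolated terms in the compatibility laws. *)
Lemma sum_shuffle_wd u v : uniq u -> uniq v -> allrel ltn u v ->
  \sum_(w <- shuffle u v) wd w =
  mul (wd u) (wd v) + (if u == [::] then wd v else 0) + (if v == [::] then wd u else 0).
Proof.
move=> Uu Uv lt_uv; case: (eqVneq u [::]) => [->|u_n0].
  by rewrite big_seq1 wd_nil mul0l add0r if_same addr0.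
case: (eqVneq v [::]) => [->|v_n0].
  by rewrite shuffle_nilr big_seq1 wd_nil mul0r addr0 add0r.
by rewrite (mul_wd Uu Uv lt_uv) // !addr0.
Qed.

Lemma sum_nw_shuffle_wd m u v : uniq u -> uniq v -> allrel ltn u v -> is_top m u ->
  \sum_(w <- nw_shuffle m u v) wd w =
  nw (wd u) (wd v) + (if v == [::] then wd u else 0).
Proof.
move=> Uu Uv lt_uv m_top; case: (eqVneq v [::]) => [->|v_n0].
  have [m_u _] := andP m_top.
  rewrite nw_shuffleE ?cats0 // shuffle_nilr filter_predT.
  by rewrite big_seq1 wd_nil nw0r add0r.
by rewrite (nw_wd Uu Uv lt_uv m_top) // addr0.
Qed.

Lemma tlift_sum_wd (W : lmodType K) (F : A -> A -> W) s (P : pred (seq nat * seq nat)) :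
  bilinear_map F ->
  tlift AA F (\sum_(p <- s | P p) (wd p.1 ⊗ wd p.2)) = \sum_(p <- s | P p) F (wd p.1) (wd p.2).
Proof.
move=> F_bil; rewrite (linear_to_sum _ _ _ (tlift_linear F_bil)).
by apply: eq_bigr => p _; rewrite (tlift_tmul AA F_bil).
Qed.

Lemma tmul_sum I J (r : seq I) (s : seq J) (F : I -> A) (G : J -> A) :
  \sum_(i <- r) \sum_(j <- s) (F i ⊗ G j) =
  (\sum_(i <- r) F i) ⊗ (\sum_(j <- s) G j) :> AA.
Proof.
rewrite (linear_to_sum (f := fun x => x ⊗ _) _ _ _ (tmul2_bil.1 _)).
by apply: eq_bigr => i _; rewrite (linear_to_sum _ _ _ (tmul2_bil.2 _)).
Qed.

(** Both coproducts at once: [m] will be the greatest letter of the shuffles, and [P]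
    the identity or the negation, to ask for [m] in the prefix or in the suffix.  The terms with an empty prefix of [v] only
    occur if [P false], those with an empty suffix of [v] only if [P true]. *)
Lemma coproduct_shuffle (P : pred bool) m u v :
  uniq u -> uniq v -> u != [::] -> v != [::] -> allrel ltn u v -> m \in v ->
  \sum_(w <- shuffle u v) \sum_(p <- splits w | P (m \in p.1)) (wd p.1 ⊗ wd p.2 : AA) =
  (if P true then wd v ⊗ wd u else 0)
  + (if P false then wd u ⊗ wd v else 0)
  + \sum_(q <- splits v | P (m \in q.1)) (wd q.1 ⊗ mul (wd u) (wd q.2))
  + \sum_(q <- splits v | P (m \in q.1)) (mul (wd u) (wd q.1) ⊗ wd q.2)
  + (if P true then \sum_(p <- splits u) (mul (wd p.1) (wd v) ⊗ wd p.2) else 0)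
  + (if P false then \sum_(p <- splits u) (wd p.1 ⊗ mul (wd p.2) (wd v)) else 0)
  + \sum_(p <- splits u) \sum_(q <- splits v | P (m \in q.1))
      (mul (wd p.1) (wd q.1) ⊗ mul (wd p.2) (wd q.2)).
Proof.
move=> Uu Uv u_n0 v_n0 lt_uv m_v.
have m_u := allrel_ltn_notin lt_uv m_v.
under eq_bigr => w _ do rewrite big_mkcond.
rewrite (splits_shuffle (fun x y => if P (m \in x) then wd x ⊗ wd y else 0 : AA)).
pose t p q :=
  (if p.1 == [::] then (if q.2 == [::] then wd q.1 ⊗ wd p.2 else 0) else 0)
  + (if q.1 == [::] then (if p.2 == [::] then wd p.1 ⊗ wd q.2 else 0) else 0)
  + (if p.1 == [::] then wd q.1 ⊗ mul (wd p.2) (wd q.2) else 0)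
  + (if p.2 == [::] then mul (wd p.1) (wd q.1) ⊗ wd q.2 else 0)
  + (if q.2 == [::] then mul (wd p.1) (wd q.1) ⊗ wd p.2 else 0)
  + (if q.1 == [::] then wd p.1 ⊗ mul (wd p.2) (wd q.2) else 0)
  + mul (wd p.1) (wd q.1) ⊗ mul (wd p.2) (wd q.2) : AA.
transitivity (\sum_(p <- splits u) \sum_(q <- splits v | P (m \in q.1)) t p q).
  apply: eq_big_seq => p p_u; rewrite [RHS]big_mkcond; apply: eq_big_seq => q q_v.
  have [Up1 Up2 p1_u p2_u] := splits_sub Uu p_u.
  have [Uq1 Uq2 q1_v q2_v] := splits_sub Uv q_v.
  transitivity (if P (m \in q.1) then
      (\sum_(x <- shuffle p.1 q.1) wd x) ⊗ (\sum_(y <- shuffle p.2 q.2) wd y) else 0 : AA).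
    rewrite -tmul_sum -sum_if0; apply: eq_big_seq => x /shuffle_perm/perm_mem x_pq.
    rewrite sum_if0 x_pq mem_cat; case: (boolP (m \in p.1)) => // /p1_u.
    by rewrite (negPf m_u).
  congr (if _ then _ else _).
  (* The product of the two expansions has nine terms; two of them vanish because
     the pieces of the nonempty words u and v are not both empty. *)
  rewrite !sum_shuffle_wd ?(allrel_sub _ _ lt_uv) // /t.
  have : (p.1 == [::]) && (p.2 == [::]) = false.
    apply/negbTE; apply: contra u_n0 => /andP[/eqP p1 /eqP p2].
    by move: p_u; rewrite mem_splits p1 p2 eq_sym.
  have : (q.1 == [::]) && (q.2 == [::]) = false.
    apply/negbTE; apply: contra v_n0 => /andP[/eqP q1 /eqP q2].
    by move: q_v; rewrite mem_splits q1 q2 eq_sym.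
  case: eqVneq => [->|_]; case: eqVneq => [->|_]; case: eqVneq => [->|_];
   case: eqVneq => [->|_] //= _ _; rewrite ?zero_simp //.
(* Each term that asks for an empty piece is a single sum, or a single tensor. *)
rewrite /t; under eq_bigr => p _ do rewrite !big_split.
rewrite !big_split.
have Pm_v : P (m \in v) = P true by rewrite m_v.
have Pm_nil : P (m \in [::]) = P false by [].
pose R (x : seq nat) := P (m \in x).
congr (_ + _ + _ + _ + _ + _ + _).
- rewrite (sum2_prefix_nil_l R xpredT u v (fun _ b c d => if d == [::] then wd c ⊗ wd b else 0)).
  by rewrite (sum_splits_suffix_nil_cond R (fun c d => wd c ⊗ wd u)) /R Pm_v.
- rewrite (sum2_prefix_nil_r R xpredT u v (fun a b _ d => if b == [::] then wd a ⊗ wd d else 0)).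
  by rewrite (sum_splits_suffix_nil_cond xpredT (fun a b => wd a ⊗ wd v)) /R Pm_nil.
- exact: (sum2_prefix_nil_l R xpredT u v (fun _ b c d => wd c ⊗ mul (wd b) (wd d))).
- exact: (sum2_suffix_nil_l R xpredT u v (fun a _ c d => mul (wd a) (wd c) ⊗ wd d)).
- rewrite (sum2_suffix_nil_r R xpredT u v (fun a b c _ => mul (wd a) (wd c) ⊗ wd b)).
  by rewrite /R Pm_v.
- exact: (sum2_prefix_nil_r R xpredT u v (fun a b _ d => wd a ⊗ mul (wd b) (wd d))).
Qed.

Lemma coproduct_mul (P : pred bool) (D : A -> AA) m u v :
  linear D ->
  (forall w, uniq w -> is_top m w ->
    D (wd w) = \sum_(p <- splits w | P (m \in p.1)) (wd p.1 ⊗ wd p.2)) ->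
  uniq u -> uniq v -> u != [::] -> allrel ltn u v -> is_top m v ->
  D (mul (wd u) (wd v)) =
  (if P true then wd v ⊗ wd u else 0)
  + (if P false then wd u ⊗ wd v else 0)
  + tlift AA (fun y1 y2 => y1 ⊗ mul (wd u) y2) (D (wd v))
  + tlift AA (fun y1 y2 => mul (wd u) y1 ⊗ y2) (D (wd v))
  + (if P true then tlift AA (fun x1 x2 => mul x1 (wd v) ⊗ x2) (tilde (wd u)) else 0)
  + (if P false then tlift AA (fun x1 x2 => x1 ⊗ mul x2 (wd v)) (tilde (wd u)) else 0)
  + tlift AA (fun x1 x2 =>
      tlift AA (fun y1 y2 => mul x1 y1 ⊗ mul x2 y2) (D (wd v))) (tilde (wd u)).
Proof.
move=> D_lin D_wd Uu Uv u_n0 lt_uv m_top.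
have [m_v _] := andP m_top; have v_n0 : v != [::] by apply: contraTneq m_v => ->.
have [l l_top] := ex_top u_n0; have Uuv := allrel_ltn_uniq Uu Uv lt_uv.
rewrite (D_wd v) // (tilde_wd Uu l_top) mul_wd // (linear_to_sum _ _ _ D_lin).
rewrite !tlift_sum_wd; try by lin.
under [X in _ = _ + X]eq_bigr => p _.
  rewrite tlift_sum_wd; last by lin.
over.
rewrite -(coproduct_shuffle P Uu Uv u_n0 v_n0 lt_uv m_v).
apply: eq_big_seq => w w_uv; apply: D_wd.
  by rewrite (perm_uniq (shuffle_perm w_uv)).
exact: top_shuffle (allrel_top lt_uv m_top) w_uv.
Qed.

Lemma prec_mul x y :
  prec (mul x y) =
      y ⊗ x
      + tlift AA (fun y1 y2 => y1 ⊗ mul x y2) (prec y)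
      + tlift AA (fun y1 y2 => mul x y1 ⊗ y2) (prec y)
      + tlift AA (fun x1 x2 => mul x1 y ⊗ x2) (tilde x)
      + tlift AA (fun x1 x2 =>
          tlift AA (fun y1 y2 => mul x1 y1 ⊗ mul x2 y2) (prec y)) (tilde x).
Proof.
move: x; apply: (@word_ext 0); [by lin | by lin | move=> u Uu u_n0 _].
have [l l_top] := ex_top u_n0.
move: y; apply: (@word_ext l); [by lin | by lin | move=> v Uv v_n0 /(top_allrel l_top) lt_uv].
have [m m_top] := ex_top v_n0.
by rewrite (coproduct_mul (P := id) prec_lin (prec_wd (m := m))) // !addr0.
Qed.

Lemma succ_mul x y :
  succ (mul x y) =
      x ⊗ y
      + tlift AA (fun y1 y2 => mul x y1 ⊗ y2) (succ y)
      + tlift AA (fun y1 y2 => y1 ⊗ mul x y2) (succ y)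
      + tlift AA (fun x1 x2 => x1 ⊗ mul x2 y) (tilde x)
      + tlift AA (fun x1 x2 =>
          tlift AA (fun y1 y2 => mul x1 y1 ⊗ mul x2 y2) (succ y)) (tilde x).
Proof.
move: x; apply: (@word_ext 0); [by lin | by lin | move=> u Uu u_n0 _].
have [l l_top] := ex_top u_n0.
move: y; apply: (@word_ext l); [by lin | by lin | move=> v Uv v_n0 /(top_allrel l_top) lt_uv].
have [m m_top] := ex_top v_n0.
rewrite (coproduct_mul (P := negb) succ_lin (succ_wd (m := m))) //= add0r addr0.
by rewrite (addrAC (_ ⊗ _)).
Qed.

(** As in [coproduct_mul], [P] selects the coproduct.  The cuts of [u] now matter: if
    the greatest letter [l] of [u] is in the prefix, the suffixes are freely shuffled
    and a product appears; if it is in the suffix, then so is the whole of [v]. *)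
Lemma coproduct_nw (P : pred bool) (D : A -> AA) l m u v :
  linear D ->
  (forall w, uniq w -> is_top m w ->
    D (wd w) = \sum_(p <- splits w | P (m \in p.1)) (wd p.1 ⊗ wd p.2)) ->
  uniq u -> uniq v -> allrel ltn u v -> is_top l u -> is_top m v ->
  D (nw (wd u) (wd v)) =
  (if P false then wd u ⊗ wd v else 0)
  + tlift AA (fun y1 y2 => nw (wd u) y1 ⊗ y2) (D (wd v))
  + (if P true then tlift AA (fun x1 x2 => nw x1 (wd v) ⊗ x2) (prec (wd u)) else 0)
  + (if P false then tlift AA (fun x1 x2 => x1 ⊗ nw x2 (wd v)) (succ (wd u)) else 0)
  + (if P false then tlift AA (fun x1 x2 => x1 ⊗ mul x2 (wd v)) (prec (wd u)) else 0)
  + tlift AA (fun x1 x2 =>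
      tlift AA (fun y1 y2 => nw x1 y1 ⊗ mul x2 y2) (D (wd v))) (prec (wd u)).
Proof.
move=> D_lin D_wd Uu Uv lt_uv l_top m_top.
have [m_v _] := andP m_top; have v_n0 : v != [::] by apply: contraTneq m_v => ->.
have /andP[l_u /allP u_l] := l_top; have u_n0 : u != [::] by apply: contraTneq l_u => ->.
have Uuv := allrel_ltn_uniq Uu Uv lt_uv.
have m_u := allrel_ltn_notin lt_uv m_v.
rewrite (D_wd v) // (prec_wd Uu l_top) (succ_wd Uu l_top).
rewrite (nw_wd Uu Uv lt_uv l_top) //.
rewrite (linear_to_sum _ _ _ D_lin) !tlift_sum_wd; try by lin.
under [X in _ = _ + X]eq_bigr => p _.
  rewrite tlift_sum_wd; last by lin.
over.
transitivity (\sum_(w <- nw_shuffle l u v) \sum_(p <- splits w)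
    (if P (m \in p.1) then wd p.1 ⊗ wd p.2 else 0 : AA)).
  apply: eq_big_seq => w /(nw_shuffle_sub Uuv l_u) w_uv; rewrite D_wd ?big_mkcond //.
    by rewrite (perm_uniq (shuffle_perm w_uv)).
  exact: top_shuffle (allrel_top lt_uv m_top) w_uv.
rewrite (splits_nw_shuffle (fun x y => if P (m \in x) then wd x ⊗ wd y else 0 : AA)) //.
rewrite (bigID (fun p => l \in p.1)) /=.
pose t p q :=
  (if q.1 == [::] then (if p.2 == [::] then wd p.1 ⊗ wd q.2 else 0) else 0)
  + (if p.2 == [::] then nw (wd p.1) (wd q.1) ⊗ wd q.2 else 0)
  + (if q.2 == [::] then nw (wd p.1) (wd q.1) ⊗ wd p.2 else 0)
  + (if q.1 == [::] then wd p.1 ⊗ mul (wd p.2) (wd q.2) else 0)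
  + nw (wd p.1) (wd q.1) ⊗ mul (wd p.2) (wd q.2) : AA.
transitivity (\sum_(p <- splits u | l \in p.1) \sum_(q <- splits v | P (m \in q.1)) t p q
  + if P false then \sum_(p <- splits u | l \notin p.1) (wd p.1 ⊗ nw (wd p.2) (wd v)) else 0).
  congr (_ + _).
    rewrite [LHS]big_seq_cond [RHS]big_seq_cond; apply: eq_bigr => p /andP[p_u l_p1].
    rewrite l_p1 [RHS]big_mkcond; apply: eq_big_seq => q q_v.
    have [Up1 Up2 p1_u p2_u] := splits_sub Uu p_u.
    have [Uq1 Uq2 q1_v q2_v] := splits_sub Uv q_v.
    have p1_top : is_top l p.1.
      by rewrite /is_top l_p1; apply/allP => x /p1_u/u_l.
    transitivity (if P (m \in q.1) then
        (\sum_(x <- nw_shuffle l p.1 q.1) wd x) ⊗ (\sum_(y <- shuffle p.2 q.2) wd y) else 0 : AA).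
      rewrite -tmul_sum -sum_if0; apply: eq_big_seq => x.
      have Upq1 := allrel_ltn_uniq Up1 Uq1 (allrel_sub p1_u q1_v lt_uv).
      move=> /(nw_shuffle_sub Upq1 l_p1) /shuffle_perm/perm_mem x_pq.
      rewrite sum_if0 x_pq mem_cat; case: (boolP (m \in p.1)) => // /p1_u.
      by rewrite (negPf m_u).
    congr (if _ then _ else _).
    rewrite sum_shuffle_wd ?(allrel_sub _ _ lt_uv) // /t.
    rewrite (sum_nw_shuffle_wd _ _ _ p1_top) ?(allrel_sub _ _ lt_uv) // /t.
    have : (q.1 == [::]) && (q.2 == [::]) = false.
      apply/negbTE; apply: contra v_n0 => /andP[/eqP q1 /eqP q2].
      by move: q_v; rewrite mem_splits q1 q2 eq_sym.
    case: eqVneq => [->|_]; case: eqVneq => [->|_]; case: eqVneq => [->|_];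
     rewrite //= => _; rewrite ?zero_simp //.
  rewrite -sum_if0 [LHS]big_seq_cond [RHS]big_seq_cond.
  apply: eq_bigr => p /andP[p_u l_p1]; rewrite (negPf l_p1).
  have [Up1 Up2 p1_u p2_u] := splits_sub Uu p_u.
  have p2_top : is_top l p.2.
    apply/andP; split; last by apply/allP => x /p2_u/u_l.
    by move: p_u l_u; rewrite mem_splits => /eqP <-; rewrite mem_cat (negPf l_p1).
  rewrite sum_if0; have -> : (m \in p.1) = false by apply: contraNF m_u => /p1_u.
  congr (if _ then _ else _).
  rewrite (nw_wd Up2 Uv (allrel_sub p2_u _ lt_uv) p2_top) //.
  by rewrite (linear_to_sum (f := fun y => _ ⊗ y) _ _ _ (tmul2_bil.2 _)).
rewrite /t; under [X in X + _ = _]eq_bigr => p _ do rewrite !big_split.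
rewrite !big_split /=.
have Pm_v : P (m \in v) = P true by rewrite m_v.
have Pm_nil : P (m \in [::]) = P false by [].
pose R (x : seq nat) := P (m \in x).
pose L (x : seq nat) := l \in x.
rewrite [X in X + _ + _ + _ + _](_ : _ = if P false then wd u ⊗ wd v else 0); last first.
  rewrite (sum2_prefix_nil_r R L u v (fun a b _ d => if b == [::] then wd a ⊗ wd d else 0)).
  by rewrite (sum_splits_suffix_nil_cond L (fun a b => wd a ⊗ wd v)) /R /L l_u Pm_nil.
rewrite (sum2_suffix_nil_l R L u v (fun a _ c d => nw (wd a) (wd c) ⊗ wd d)).
rewrite (sum2_suffix_nil_r R L u v (fun a b c _ => nw (wd a) (wd c) ⊗ wd b)).
rewrite (sum2_prefix_nil_r R L u v (fun a b _ d => wd a ⊗ mul (wd b) (wd d))).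
rewrite /R /L l_u Pm_v Pm_nil.
by rewrite -!addrA; do 3! congr (_ + _); rewrite addrA addrC.
Qed.

Lemma prec_nw x y :
  prec (nw x y) =
      tlift AA (fun y1 y2 => nw x y1 ⊗ y2) (prec y)
      + tlift AA (fun x1 x2 => nw x1 y ⊗ x2) (prec x)
      + tlift AA (fun x1 x2 =>
          tlift AA (fun y1 y2 => nw x1 y1 ⊗ mul x2 y2) (prec y)) (prec x).
Proof.
move: x; apply: (@word_ext 0); [by lin | by lin | move=> u Uu u_n0 _].
have [l l_top] := ex_top u_n0.
move: y; apply: (@word_ext l); [by lin | by lin | move=> v Uv v_n0 /(top_allrel l_top) lt_uv].
have [m m_top] := ex_top v_n0.
rewrite (coproduct_nw (P := id) prec_lin (prec_wd (m := m)) Uu Uv lt_uv l_top m_top).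
by rewrite add0r !addr0.
Qed.

Lemma succ_nw x y :
  succ (nw x y) =
      x ⊗ y
      + tlift AA (fun y1 y2 => nw x y1 ⊗ y2) (succ y)
      + tlift AA (fun x1 x2 => x1 ⊗ nw x2 y) (succ x)
      + tlift AA (fun x1 x2 => x1 ⊗ mul x2 y) (prec x)
      + tlift AA (fun x1 x2 =>
          tlift AA (fun y1 y2 => nw x1 y1 ⊗ mul x2 y2) (succ y)) (prec x).
Proof.
move: x; apply: (@word_ext 0); [by lin | by lin | move=> u Uu u_n0 _].
have [l l_top] := ex_top u_n0.
move: y; apply: (@word_ext l); [by lin | by lin | move=> v Uv v_n0 /(top_allrel l_top) lt_uv].
have [m m_top] := ex_top v_n0.
rewrite (coproduct_nw (P := negb) succ_lin (succ_wd (m := m)) Uu Uv lt_uv l_top m_top).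
by rewrite /= !addr0.
Qed.

Lemma mul_suml I (r : seq I) (F : I -> A) y :
  mul (\sum_(i <- r) F i) y = \sum_(i <- r) mul (F i) y.
Proof. exact: (linear_to_sum _ _ _ (mul_bil.1 y)). Qed.

Lemma mul_sumr I (r : seq I) (F : I -> A) x :
  mul x (\sum_(i <- r) F i) = \sum_(i <- r) mul x (F i).
Proof. exact: (linear_to_sum _ _ _ (mul_bil.2 x)). Qed.

Lemma nw_suml I (r : seq I) (F : I -> A) y :
  nw (\sum_(i <- r) F i) y = \sum_(i <- r) nw (F i) y.
Proof. exact: (linear_to_sum _ _ _ (nw_bil.1 y)). Qed.

Lemma nw_sumr I (r : seq I) (F : I -> A) x :
  nw x (\sum_(i <- r) F i) = \sum_(i <- r) nw x (F i).
Proof. exact: (linear_to_sum _ _ _ (nw_bil.2 x)). Qed.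

(** Trilinear identities need only be checked on words over increasing alphabets. *)
Lemma word_ext3 (W : lmodType K) (f g : A -> A -> A -> W) :
  (forall y z, linear (fun x => f x y z)) -> (forall y z, linear (fun x => g x y z)) ->
  (forall x z, linear (fun y => f x y z)) -> (forall x z, linear (fun y => g x y z)) ->
  (forall x y, linear (f x y)) -> (forall x y, linear (g x y)) ->
  (forall k l m u v z, uniq u -> uniq v -> uniq z ->
    allrel ltn u v -> allrel ltn v z -> allrel ltn u z ->
    is_top k u -> is_top l v -> is_top m z ->
    f (wd u) (wd v) (wd z) = g (wd u) (wd v) (wd z)) ->
  forall x y z, f x y z = g x y z.
Proof.
move=> f1 g1 f2 g2 f3 g3 eq_fg x y z.
apply: (@word_ext 0 _ (fun x => f x y z) (fun x => g x y z)) => // u Uu u_n0 _.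
have [k u_top] := ex_top u_n0.
apply: (@word_ext k _ (fun y => f (wd u) y z) (fun y => g (wd u) y z)) => //.
move=> v Uv v_n0 /(top_allrel u_top) lt_uv; have [l v_top] := ex_top v_n0.
apply: (@word_ext l _ (f (wd u) (wd v)) (g (wd u) (wd v))) => //.
move=> w Uw w_n0 /(top_allrel v_top) lt_vw; have [m w_top] := ex_top w_n0.
apply: (eq_fg k l m) => //; apply/allrelP => a b a_u b_w.
have [l_v _] := andP v_top.
exact: ltn_trans (allrelP lt_uv a l a_u l_v) (allrelP lt_vw l b l_v b_w).
Qed.

Lemma mul_assoc x y z : mul (mul x y) z = mul x (mul y z).
Proof.
move: x y z; apply: (@word_ext3 _ (fun x y z => mul (mul x y) z)
  (fun x y z => mul x (mul y z))); try lin.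
move=> k l m u v z Uu Uv Uz lt_uv lt_vz lt_uz u_top v_top z_top.
have [u_n0 v_n0 z_n0] := And3 (top_nonempty u_top) (top_nonempty v_top) (top_nonempty z_top).
have Uuv := allrel_ltn_uniq Uu Uv lt_uv; have Uvz := allrel_ltn_uniq Uv Uz lt_vz.
rewrite (mul_wd Uu) // mul_suml (mul_wd Uv) // mul_sumr.
transitivity (\sum_(w <- shuffle u v) \sum_(t <- shuffle w z) wd t).
  apply: eq_big_seq => w w_uv; have w_perm := shuffle_perm w_uv.
  rewrite mul_wd ?(perm_uniq w_perm) ?(perm_cat_allrel_l w_perm) //.
  exact/top_nonempty/(top_shuffle v_top (allrel_top lt_uv v_top) w_uv).
rewrite shuffle_assoc; apply: eq_big_seq => w w_vz; have w_perm := shuffle_perm w_vz.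
rewrite mul_wd ?(perm_uniq w_perm) ?(perm_cat_allrel_r w_perm) //.
exact/top_nonempty/(top_shuffle z_top (allrel_top lt_vz z_top) w_vz).
Qed.

Lemma mul_nw_assoc x y z : nw (mul x y) z = mul x (nw y z).
Proof.
move: x y z; apply: (@word_ext3 _ (fun x y z => nw (mul x y) z)
  (fun x y z => mul x (nw y z))); try lin.
move=> k l m u v z Uu Uv Uz lt_uv lt_vz lt_uz u_top v_top z_top.
have [u_n0 v_n0 z_n0] := And3 (top_nonempty u_top) (top_nonempty v_top) (top_nonempty z_top).
have Uuv := allrel_ltn_uniq Uu Uv lt_uv; have Uvz := allrel_ltn_uniq Uv Uz lt_vz.
have [l_v _] := andP v_top.
rewrite (mul_wd Uu) // nw_suml (nw_wd Uv Uz lt_vz v_top) // mul_sumr.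
transitivity (\sum_(w <- shuffle u v) \sum_(t <- nw_shuffle l w z) wd t).
  apply: eq_big_seq => w w_uv; have w_perm := shuffle_perm w_uv.
  by rewrite (nw_wd (m := l)) ?(perm_uniq w_perm) ?(perm_cat_allrel_l w_perm) //
    (top_shuffle v_top (allrel_top lt_uv v_top) w_uv).
rewrite shuffle_nw_shuffle_assoc ?(allrel_ltn_notin lt_uv l_v) //.
apply: eq_big_seq => w /(nw_shuffle_sub Uvz l_v) w_vz; have w_perm := shuffle_perm w_vz.
rewrite mul_wd ?(perm_uniq w_perm) ?(perm_cat_allrel_r w_perm) //.
exact/top_nonempty/(top_shuffle z_top (allrel_top lt_vz z_top) w_vz).
Qed.

Lemma nw_assoc x y z : nw (nw x y) z = nw x (nw y z).
Proof.
move: x y z; apply: (@word_ext3 _ (fun x y z => nw (nw x y) z)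
  (fun x y z => nw x (nw y z))); try lin.
move=> k l m u v z Uu Uv Uz lt_uv lt_vz lt_uz u_top v_top z_top.
have [u_n0 v_n0 z_n0] := And3 (top_nonempty u_top) (top_nonempty v_top) (top_nonempty z_top).
have Uuv := allrel_ltn_uniq Uu Uv lt_uv; have Uvz := allrel_ltn_uniq Uv Uz lt_vz.
have [l_v _] := andP v_top; have [k_u _] := andP u_top.
rewrite (nw_wd Uu Uv lt_uv u_top) // nw_suml (nw_wd Uv Uz lt_vz v_top) // nw_sumr.
transitivity (\sum_(w <- nw_shuffle k u v) \sum_(t <- nw_shuffle l w z) wd t).
  apply: eq_big_seq => w /(nw_shuffle_sub Uuv k_u) w_uv; have w_perm := shuffle_perm w_uv.
  by rewrite (nw_wd (m := l)) ?(perm_uniq w_perm) ?(perm_cat_allrel_l w_perm) //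
    (top_shuffle v_top (allrel_top lt_uv v_top) w_uv).
rewrite nw_shuffle_assoc ?(allrel_ltn_notin lt_uv l_v) //.
apply: eq_big_seq => w /(nw_shuffle_sub Uvz l_v) w_vz; have w_perm := shuffle_perm w_vz.
rewrite (nw_wd Uu _ _ u_top) ?(perm_uniq w_perm) ?(perm_cat_allrel_r w_perm) //.
exact/top_nonempty/(top_shuffle z_top (allrel_top lt_vz z_top) w_vz).
Qed.

Lemma tilde_wd_uniq w : uniq w -> tilde (wd w) = \sum_(p <- splits w) (wd p.1 ⊗ wd p.2).
Proof.
case: (eqVneq w [::]) => [-> _ | /ex_top[m m_top] Uw]; last exact: tilde_wd Uw m_top.
by rewrite /splits big_seq1 wd_nil tmul0l (linear_to0 tilde_lin).
Qed.

Lemma idr_wd (D : A -> AA) (P Q : pred (seq nat)) w : linear D ->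
  (forall p, p \in splits w -> Q p.1 ->
    D (wd p.1) = \sum_(q <- splits p.1 | P q.1) (wd q.1 ⊗ wd q.2)) ->
  tensor_idr AAA D (\sum_(p <- splits w | Q p.1) (wd p.1 ⊗ wd p.2)) =
  \sum_(p <- splits w) \sum_(q <- splits p.1)
    if Q p.1 && P q.1 then wd q.1 ⊗ (wd q.2 ⊗ wd p.2) else 0.
Proof.
move=> D_lin D_wd; rewrite /tensor_idr tlift_sum_wd; last by lin.
rewrite big_mkcond; apply: eq_big_seq => p p_w.
case: ifP => [Qp | _]; last by rewrite big1.
rewrite D_wd // tlift_sum_wd; last by lin.
by rewrite big_mkcond.
Qed.

Lemma idl_wd (D : A -> AA) (P Q : pred (seq nat)) w : linear D ->
  (forall p, p \in splits w -> Q p.1 ->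
    D (wd p.2) = \sum_(q <- splits p.2 | P q.1) (wd q.1 ⊗ wd q.2)) ->
  tensor_idl AAA D (\sum_(p <- splits w | Q p.1) (wd p.1 ⊗ wd p.2)) =
  \sum_(p <- splits w) \sum_(q <- splits p.2)
    if Q p.1 && P q.1 then wd p.1 ⊗ (wd q.1 ⊗ wd q.2) else 0.
Proof.
move=> D_lin D_wd; rewrite /tensor_idl tlift_sum_wd; last by lin.
rewrite big_mkcond; apply: eq_big_seq => p p_w.
case: ifP => [Qp | _]; last by rewrite big1.
rewrite D_wd // (linear_to_sum _ _ _ (tmul3_bil.2 _)).
by rewrite big_mkcond.
Qed.

(** Each codendriform law sums over the factorizations of [w] into three words with
    the greatest letter in a prescribed one.  The last hypothesis compares the
    conditions put on the three factors by the two sides, knowing that exactly one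
    of them contains [m]. *)
Lemma coassoc_wd (D1 D2 D3 D4 : A -> AA) (P1 P2 P3 P4 : pred bool) m w :
  uniq w -> is_top m w ->
  linear D1 -> linear D2 -> linear D3 -> linear D4 ->
  (forall p, p \in splits w -> P2 (m \in p.1) ->
    D1 (wd p.1) = \sum_(q <- splits p.1 | P1 (m \in q.1)) (wd q.1 ⊗ wd q.2)) ->
  (D2 (wd w) = \sum_(p <- splits w | P2 (m \in p.1)) (wd p.1 ⊗ wd p.2)) ->
  (forall p, p \in splits w -> P4 (m \in p.1) ->
    D3 (wd p.2) = \sum_(q <- splits p.2 | P3 (m \in q.1)) (wd q.1 ⊗ wd q.2)) ->
  (D4 (wd w) = \sum_(p <- splits w | P4 (m \in p.1)) (wd p.1 ⊗ wd p.2)) ->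
  (forall a b c : bool, (a + b + c = 1)%N -> P2 (a || b) && P1 a = P4 a && P3 b) ->
  tensor_idr AAA D1 (D2 (wd w)) = tensor_idl AAA D3 (D4 (wd w)).
Proof.
move=> Uw m_top D1l D2l D3l D4l E1 E2 E3 E4 P_eq; rewrite E2 E4.
rewrite (idr_wd (P := fun x => P1 (m \in x)) (Q := fun x => P2 (m \in x)) D1l E1).
rewrite (idl_wd (P := fun x => P3 (m \in x)) (Q := fun x => P4 (m \in x)) D3l E3).
have [m_w _] := andP m_top.
rewrite -(splits_coassoc (fun a b c =>
  if P4 (m \in a) && P3 (m \in b) then wd a ⊗ (wd b ⊗ wd c) else 0)).
apply: eq_big_seq => p; rewrite mem_splits => /eqP def_w.
apply: eq_big_seq => q; rewrite mem_splits => /eqP def_p.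
congr (if _ then _ else _); rewrite -def_p mem_cat; apply: (P_eq _ _ (m \in p.2)).
by apply: mem_cat3_uniq; rewrite catA def_p def_w.
Qed.

Lemma prec_prec x : tensor_idr AAA prec (prec x) = tensor_idl AAA tilde (prec x).
Proof.
move: x; apply: (@word_ext 0); [by rewrite /tensor_idr; lin | by rewrite /tensor_idl; lin |].
move=> w Uw /ex_top[m m_top] _.
apply: (coassoc_wd (P1 := id) (P2 := id) (P3 := xpredT) (P4 := id) Uw m_top) => //.
- exact: tilde_lin.
- move=> p p_w m_p; apply: prec_wd; last exact: (top_cat_l m_top p_w m_p).
  by have [] := splits_sub Uw p_w.
- exact: prec_wd.
- by move=> p /(splits_sub Uw)[_ U2 _ _] _; rewrite tilde_wd_uniq.
- exact: prec_wd.
- by case=> [] [] [].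
Qed.

Lemma succ_prec x : tensor_idr AAA succ (prec x) = tensor_idl AAA prec (succ x).
Proof.
move: x; apply: (@word_ext 0); [by rewrite /tensor_idr; lin | by rewrite /tensor_idl; lin |].
move=> w Uw /ex_top[m m_top] _.
apply: (coassoc_wd (P1 := negb) (P2 := id) (P3 := id) (P4 := negb) Uw m_top) => //.
- move=> p p_w m_p; apply: succ_wd; last exact: (top_cat_l m_top p_w m_p).
  by have [] := splits_sub Uw p_w.
- exact: prec_wd.
- move=> p p_w m_p; apply: prec_wd; last exact: (top_cat_r m_top p_w m_p).
  by have [] := splits_sub Uw p_w.
- exact: succ_wd.
- by case=> [] [] [].
Qed.

Lemma tilde_succ x : tensor_idr AAA tilde (succ x) = tensor_idl AAA succ (succ x).
Proof.
move: x; apply: (@word_ext 0); [by rewrite /tensor_idr; lin | by rewrite /tensor_idl; lin |].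
move=> w Uw /ex_top[m m_top] _.
apply: (coassoc_wd (P1 := xpredT) (P2 := negb) (P3 := negb) (P4 := negb) Uw m_top) => //.
- exact: tilde_lin.
- by move=> p /(splits_sub Uw)[U1 _ _ _] _; rewrite tilde_wd_uniq.
- exact: succ_wd.
- move=> p p_w m_p; apply: succ_wd; last exact: (top_cat_r m_top p_w m_p).
  by have [] := splits_sub Uw p_w.
- exact: succ_wd.
- by case=> [] [] [].
Qed.

(** The laws follow from the word formulas alone, for any family [wd] of vectors that
    spans the space in the sense of [word_ext]. *)
Lemma dupdend_of_words : dupdend_bialgebra AAA O.
Proof.
by split; do ?[exact: mul_bil | exact: nw_bil | exact: prec_lin | exact: succ_lin
  | exact: mul_assoc | exact: nw_assoc | exact: mul_nw_assoc
  | exact: prec_prec | exact: succ_prec | exact: tilde_succ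
  | exact: prec_mul | exact: succ_mul | exact: prec_nw | exact: succ_nw].
Qed.

End DupDendOfWords.

Lemma FQSym_dupdend (K : fieldType) : dupdend_bialgebra (FQSym3 K) (FQSym_ops K).
Proof.
apply: (@dupdend_of_words _ _ _ _ _ (fq_word K)).
- exact: bilinext_bilinear.
- exact: bilinext_bilinear.
- exact: linext_linear.
- exact: linext_linear.
- exact: word_ext.
- exact: fq_word_nil.
- exact: mul_fq_word.
- by move=> m u v Uu Uv lt_uv; apply: nw_fq_word.
- exact: prec_fq_word.
- exact: succ_fq_word.
Qed.

(** * Permutations of a union, and cuts of permutations *)

(** The map [g], which recovers from an entry the list it comes from, shows that these
    lists are disjoint. *)
Lemma flatten_map_uniq (S T : eqType) (f : S -> seq T) (g : T -> S) s :
  uniq s -> {in s, forall x, uniq (f x)} ->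
  {in s, forall x, {in f x, forall y, g y = x}} -> uniq (flatten (map f s)).
Proof.
elim: s => //= x s IHs /andP[x_s Us] Uf fK; rewrite cat_uniq Uf ?mem_head //=.
rewrite IHs // => [|y y_s|y y_s]; first rewrite andbT.
- apply/hasPn => y /flatten_mapP[z z_s y_z]; apply: contraNN x_s => y_x.
  by rewrite -(fK x _ y y_x) ?mem_head // (fK z _ y y_z) // inE z_s orbT.
- by apply: Uf; rewrite inE y_s orbT.
- by apply: fK; rewrite inE y_s orbT.
Qed.

Lemma sum_flatten_map (V : nmodType) (S T : Type) (f : S -> seq T) (F : T -> V) s :
  \sum_(y <- flatten (map f s)) F y = \sum_(x <- s) \sum_(y <- f x) F y.
Proof. by rewrite big_flatten big_map. Qed.

Lemma perm_permutations_map (S T : eqType) (f : S -> T) s :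
  injective f -> uniq s ->
  perm_eq (permutations (map f s)) (map (map f) (permutations s)).
Proof.
move=> f_inj Us; rewrite perm_sym.
have Ufs : uniq (map f s) by rewrite map_inj_uniq.
have U1 : uniq (map (map f) (permutations s)).
  by rewrite map_inj_uniq ?permutations_uniq //; apply: inj_map.
apply: uniq_perm => //; first exact: permutations_uniq.
have [] := uniq_min_size (s2 := permutations (map f s)) U1.
- by move=> _ /mapP[w + ->]; rewrite !mem_permutations; apply: perm_map.
- by rewrite size_map !size_permutations // size_map.
by [].
Qed.

(** A permutation of a disjoint union is a shuffle of its restrictions to the two
    parts. *)
Lemma sum_permutations_cat (T : eqType) (V : nmodType) (F : seq T -> V) A B :
  uniq (A ++ B) ->
  \sum_(w <- permutations (A ++ B)) F w =
  \sum_(u <- permutations A) \sum_(v <- permutations B) \sum_(w <- shuffle u v) F w.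
Proof.
move=> UAB.
have shuffleE u v : perm_eq u A -> perm_eq v B ->
    uniq (shuffle u v) /\ (forall w, w \in shuffle u v ->
    filter [in A] w = u /\ filter (predC [in A]) w = v).
  move=> uA vB; split; first by rewrite shuffle_uniq // (perm_uniq (perm_cat uA vB)).
  move=> w; rewrite (@mem_shuffle _ [in A]).
  - by case/andP=> /eqP-> /eqP->.
  - by apply/allP => x; rewrite (perm_mem uA).
  - apply/allP => x; rewrite (perm_mem vB) => x_B; move: UAB.
    by rewrite cat_uniq => /and3P[_ /hasPn/(_ x x_B)].
under [RHS]eq_bigr => u _ do rewrite -sum_flatten_map.
rewrite -sum_flatten_map; apply: perm_big; apply: uniq_perm.
- exact: permutations_uniq.
- apply: (flatten_map_uniq (g := filter [in A])); first exact: permutations_uniq.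
    move=> u; rewrite mem_permutations => uA.
    apply: (flatten_map_uniq (g := filter (predC [in A]))); first exact: permutations_uniq.
      by move=> v; rewrite mem_permutations => /(shuffleE u v uA)[].
    move=> v; rewrite mem_permutations => vB w.
    by have [_ h] := shuffleE u v uA vB; move=> /h[].
  move=> u; rewrite mem_permutations => uA w /flatten_mapP[v].
  rewrite mem_permutations => vB.
  by have [_ h] := shuffleE u v uA vB; move=> /h[].
move=> w; rewrite mem_permutations; apply/idP/flatten_mapP => [w_AB | [u]].
  have [wA wB] : perm_eq (filter [in A] w) A /\ perm_eq (filter (predC [in A]) w) B.
    have fA : filter [in A] (A ++ B) = A.
      rewrite filter_cat (_ : filter _ B = [::]) ?cats0.
        exact/all_filterP/allP.
      apply/eqP; rewrite -size_eq0 size_filter -leqn0 leqNgt -has_count.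
      by move: UAB; rewrite cat_uniq => /and3P[].
    have fB : filter (predC [in A]) (A ++ B) = B.
      rewrite filter_cat (_ : filter _ A = [::]).
        apply/all_filterP; rewrite all_predC.
        by move: UAB; rewrite cat_uniq => /and3P[].
      apply/eqP; rewrite -size_eq0 size_filter -leqn0 leqNgt -has_count.
      by apply/hasPn => x /= ->.
    by split; [rewrite -[X in perm_eq _ X]fA | rewrite -[X in perm_eq _ X]fB];
      apply: perm_filter.
  exists (filter [in A] w); rewrite ?mem_permutations //.
  apply/flatten_mapP; exists (filter (predC [in A]) w); rewrite ?mem_permutations //.
  rewrite (@mem_shuffle _ [in A]) ?eqxx //; first exact: filter_all.
  exact: filter_all.
rewrite mem_permutations => uA /flatten_mapP[v]; rewrite mem_permutations => vB.
move=> /shuffle_perm/perm_trans->//; exact: perm_cat.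
Qed.

(** A cut permutation of [T] is the choice of the set [I] of letters of the suffix, of
    a permutation of [I] and of one of its complement. *)
Lemma sum_splits_permutations (T : finType) (V : nmodType) (G : seq T -> seq T -> V) :
  \sum_(w <- permutations (enum T)) \sum_(p <- splits w) G p.1 p.2 =
  \sum_(I : {set T}) \sum_(a <- permutations (enum (~: I)))
    \sum_(b <- permutations (enum I)) G a b.
Proof.
under [RHS]eq_bigr => I _ do
  rewrite -(big_allpairs (F := fun p : seq T * seq T => G p.1 p.2)).
rewrite -!sum_flatten_map.
apply: perm_big; apply: uniq_perm.
- apply: (flatten_map_uniq (g := fun p => p.1 ++ p.2)); first exact: permutations_uniq.
    by move=> w _; apply: splits_uniq.
  by move=> w _ p; rewrite mem_splits => /eqP.
- apply: (flatten_map_uniq (g := fun p : seq T * seq T => [set x in p.2])).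
  + exact: index_enum_uniq.
  + move=> I _; apply: allpairs_uniq; rewrite ?permutations_uniq //.
    by move=> [a b] [c d] _ _.
  + move=> I _ _ /allpairsP[[a b] [/= _ b_I ->]]; apply/setP => x.
    by rewrite inE; move: b_I; rewrite mem_permutations => /perm_mem->; rewrite mem_enum.
move=> p; apply/flatten_mapP/flatten_mapP => [[w] | [I _ /allpairsP[[a b] [/= a_I b_I ->]]]].
  rewrite mem_permutations mem_splits => w_T /eqP def_w.
  have Uw : uniq (p.1 ++ p.2) by rewrite def_w (perm_uniq w_T) enum_uniq.
  have mem_w x : (x \in p.1) || (x \in p.2).
    by rewrite -mem_cat def_w (perm_mem w_T) mem_enum.
  move: Uw; rewrite cat_uniq => /and3P[U1 /hasPn U12 U2].
  exists [set x in p.2]; first exact: mem_index_enum.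
  apply/allpairsP; exists p; rewrite !mem_permutations.
  split; last by case: p {def_w mem_w U1 U12 U2}.
    apply: uniq_perm; rewrite ?enum_uniq // => x; rewrite mem_enum !inE.
    by have := mem_w x; case: (boolP (x \in p.2)) => [/U12/negPf|]; rewrite ?orbF.
  by apply: uniq_perm; rewrite ?enum_uniq // => x; rewrite mem_enum inE.
move: a_I b_I; rewrite !mem_permutations => a_I b_I.
exists (a ++ b); last by rewrite mem_splits.
rewrite mem_permutations (perm_trans (perm_cat a_I b_I)) //.
apply: uniq_perm => [||x]; last 1 first.
- by rewrite mem_cat !mem_enum !inE orNb.
- rewrite cat_uniq !enum_uniq andbT; apply/hasPn => x.
  by rewrite /= !mem_enum inE => ->.
exact: enum_uniq.
Qed.

(** * Theta as a sum of linear extensions *)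

Section LinearExtensions.
Context (K : fieldType).
Local Notation wd := (fq_word K).

(** [follows P x y] allows [x] to stand before [y]: the linear extensions of [P] are the
    permutations of its elements that satisfy it [pairwise]. *)
Definition follows n (P : sposet n) : rel 'I_n := fun x y => ~~ le1 P y x.

Definition extsum n (P : sposet n) (s : seq 'I_n) : FQSym K :=
  \sum_(w <- permutations s | pairwise (follows P) w) wd (map val w).

Lemma eq_extsum n (P : sposet n) s t : perm_eq s t -> extsum P s = extsum P t.
Proof. by move=> eq_st; apply: perm_big; apply: perm_permutations. Qed.

Lemma pairwise_enum n (e : rel 'I_n) :
  reflect (forall i j : 'I_n, (i < j)%N -> e i j) (pairwise e (enum 'I_n)).
Proof.
case: n e => [|n] e.
  by apply: (iffP idP) => [_ [] // | _]; rewrite (size0nil (size_enum_ord 0)).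
apply: (iffP (pairwiseP ord0)) => [e_lt i j lt_ij | e_lt i j].
  by have := e_lt i j; rewrite !inE size_enum_ord !nth_ord_enum => ->.
rewrite !inE size_enum_ord => lt_i lt_j lt_ij.
by apply: e_lt; rewrite !nth_enum_ord.
Qed.

Lemma ThetaE n (P : sposet n) : Theta (sp_elt K P) = extsum P (enum 'I_n).
Proof.
case: n P => [|n] P.
  rewrite /extsum (size0nil (size_enum_ord 0)) big_mkcond big_seq1 /=.
  exact: (linear_to0 (@linext_linear _ _ _ _)).
rewrite /Theta linextU /Theta_b /extsum -[RHS]big_filter.
(* The words of permutations have letters 1, ..., n + 1, hence the shift by one. *)
set s := filter _ _; pose f (i : 'I_n.+1) : nat := i.+1.
have f_inj : injective f by move=> i j [] /val_inj.
have sP w : w \in s -> perm_eq w (enum 'I_n.+1).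
  by rewrite mem_filter mem_permutations => /andP[].
have enum_f : perm_eq (map f (enum 'I_n.+1)) (iota 1 n.+1).
  by rewrite (map_comp S val) val_enum_ord -(iotaDl 1).
transitivity (\sum_(w <- map (map f) s) wd w).
  rewrite -(@sum_perm_words K n.+1) => [||_ /mapP[w /sP w_perm ->]]; last first.
  - exact: perm_trans (perm_map f w_perm) enum_f.
  - by rewrite map_inj_uniq ?filter_uniq ?permutations_uniq //; apply: inj_map.
  apply: eq_bigl => r /=.
  have -> : word r = map f (map r (enum 'I_n.+1)) by rewrite -map_comp.
  rewrite (mem_map (inj_map f_inj)) mem_filter mem_permutations pairwise_map.
  have -> : perm_eq (map r (enum 'I_n.+1)) (enum 'I_n.+1).
    apply: uniq_perm => [||i]; rewrite ?enum_uniq //.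
      by rewrite map_inj_uniq ?enum_uniq //; apply: perm_inj.
    rewrite mem_enum inE; apply/mapP; exists (r^-1%g i); first exact: mem_enum.
    by rewrite permKV.
  rewrite andbT; apply/forallP/pairwise_enum => [r_lt i j lt_ij | r_lt i].
    apply/negP => le_ji; have /forallP/(_ (r i))/implyP := r_lt (r j).
    rewrite !permK le_ji andbT (inj_eq perm_inj) ltnNge (ltnW lt_ij) => /(_ _)/negP[] //.
    by rewrite neq_ltn lt_ij orbT.
  apply/forallP => j; apply/implyP => /andP[neq_ij le_ij].
  case: ltngtP => // [lt_ji | eq_ij].
    by have := r_lt _ _ lt_ji; rewrite /= /follows !permKV le_ij.
  by move/val_inj/perm_inj: eq_ij neq_ij => ->; rewrite eqxx.
rewrite big_map; apply: eq_big_seq => w /sP w_perm.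
rewrite (map_comp S val) (@fq_word_map K S) // map_inj_uniq //; last exact: val_inj.
by rewrite (perm_uniq w_perm) enum_uniq.
Qed.

Lemma sum_permutations_map (S T : eqType) (V : nmodType) (f : S -> T) s (F : seq T -> V) :
  injective f -> uniq s ->
  \sum_(w <- permutations (map f s)) F w = \sum_(w <- permutations s) F (map f w).
Proof.
by move=> f_inj Us; rewrite (perm_big _ (perm_permutations_map f_inj Us)) big_map.
Qed.

Lemma sorted_enum_set n (I : {set 'I_n}) : sorted ltn (map val (enum I)).
Proof.
rewrite sorted_map /enum_mem; apply: sorted_filter; first by move=> i j k; apply: ltn_trans.
have := iota_ltn_sorted 0 n; rewrite -val_enum_ord sorted_map.
by rewrite enumT.
Qed.

(** The increasing enumeration of [I] transports the linear extensions of the induced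
    poset to the orderings of [I], and standardization does not see it. *)
Lemma Theta_res n (P : sposet n) (I : {set 'I_n}) :
  Theta (sp_elt K (sp_res P I)) = extsum P (enum I).
Proof.
have enumI : perm_eq (enum I) (map enum_val (enum 'I_#|I|)).
  apply: uniq_perm => [||i]; rewrite ?enum_uniq //.
    by rewrite map_inj_uniq ?enum_uniq //; apply: enum_val_inj.
  rewrite mem_enum; apply/idP/mapP => [i_I | [j _ ->]]; last exact: enum_valP.
  by exists (enum_rank_in i_I i); rewrite ?mem_enum // enum_rankK_in.
rewrite ThetaE (eq_extsum _ enumI) /extsum big_mkcond [RHS]big_mkcond.
rewrite (sum_permutations_map _ (@enum_val_inj _ _)) ?enum_uniq //.
apply: eq_big_seq => w; rewrite mem_permutations => w_perm.
have -> : pairwise (follows P) (map enum_val w) = pairwise (follows (sp_res P I)) w.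
  rewrite pairwise_map; apply: eq_pairwise => i j.
  by rewrite /follows sposet_ofE.
congr (if _ then _ else _).
pose f i := nth 0%N (map val (enum I)) i.
have f_val (i : 'I_#|I|) : val (enum_val i) = f (val i).
  have x0 := enum_val i.
  by rewrite (enum_val_nth x0) /f (nth_map x0) -?cardE //; apply: ltn_ord.
rewrite -map_comp (eq_map (f_val : val \o enum_val =1 f \o val)) map_comp fq_word_map //.
  rewrite map_inj_uniq ?(perm_uniq w_perm) ?enum_uniq //; exact: val_inj.
(* The map f is only increasing on the indices of I, which are the letters of w. *)
have f_homo (i j : 'I_#|I|) : (i < j)%N -> (f i < f j)%N.
  apply: (sorted_ltn_nth ltn_trans 0%N (sorted_enum_set I)).
    by rewrite inE size_map -cardE.
  by rewrite inE size_map -cardE.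
move=> _ _ /mapP[i _ ->] /mapP[j _ ->]; apply/idP/idP; last exact: f_homo.
case: (ltngtP (val i) (val j)) => // [lt_ji lt_ij | ->]; last by rewrite ltnn.
by have := ltn_trans lt_ij (f_homo _ _ lt_ji); rewrite ltnn.
Qed.

End LinearExtensions.

(** * Theta is a morphism *)

Lemma pairwise_shuffle (T : eqType) (e : rel T) u v w :
  allrel e u v -> allrel e v u -> w \in shuffle u v ->
  pairwise e w = pairwise e u && pairwise e v.
Proof.
elim: u v w => [|a u IHu] v w; first by rewrite inE => _ _ /eqP->.
elim: v w => [|b v IHv] w; first by rewrite inE => _ _ /eqP->; rewrite andbT.
move=> e_uv e_vu; rewrite shuffle_cons mem_cat => /orP[] /mapP[x sh_x ->].
  move: e_uv e_vu; rewrite allrel_consl => /andP[e_a e_uv].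
  rewrite allrel_consr => /andP[_ e_vu].
  rewrite !pairwise_cons (IHu (b :: v)) // (perm_all _ (shuffle_perm sh_x)) all_cat e_a.
  by rewrite andbT !andbA.
move: e_uv e_vu; rewrite allrel_consr => /andP[_ e_uv].
rewrite allrel_consl => /andP[e_b e_vu].
rewrite pairwise_cons (IHv x) // (perm_all _ (shuffle_perm sh_x)) all_cat e_b.
by rewrite [pairwise e (b :: v)]pairwise_cons andbCA.
Qed.

Lemma shuffle_subseq (T : eqType) (u v w : seq T) : w \in shuffle u v -> subseq u w.
Proof.
elim: u v w => [|a u IHu] v w; first by rewrite sub0seq.
elim: v w => [|b v IHv] w; first by rewrite shuffle_nilr inE => /eqP->.
rewrite shuffle_cons mem_cat => /orP[] /mapP[x sh_x ->].
  by rewrite /= eqxx; apply: IHu sh_x.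
exact: subseq_trans (IHv x sh_x) (subseq_cons x b).
Qed.

(** Used with [e := follows R], where [R] is a north-west product and [k] the greatest
    element of its first factor.  The hypotheses say that the elements of [u] may
    stand before those of [v], that [k] has to, and that an element of [u] that may
    follow [k] may also follow the elements of [v].  Hence no constraint bears on
    the elements of [u] after [k], and those before [k] precede [v] as soon as [k]
    does. *)
Lemma pairwise_nw_shuffle (T : eqType) (e : rel T) k u v w :
  uniq (u ++ v) -> k \in u -> allrel e u v -> {in v, forall y, ~~ e y k} ->
  {in u & v, forall x y, e k x -> e y x} ->
  pairwise e u -> w \in shuffle u v ->
  pairwise e w = pairwise e v && all (fun b => index k w < index b w)%N v.
Proof.
move=> + + + not_e; elim: u w => // a u IHu w.
rewrite cat_cons cons_uniq pairwise_cons => /andP[a_uv Uuv] k_au e_uv e_after /andP[e_a e_u].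
have a_v b : b \in v -> a == b = false.
  by move=> b_v; apply: contraNF a_uv => /eqP->; rewrite mem_cat b_v orbT.
case: v => [|b v] in not_e IHu Uuv e_uv e_after a_uv a_v *.
  by rewrite shuffle_nilr inE => /eqP->; rewrite /= e_a.
rewrite shuffle_cons mem_cat => /orP[] /mapP[x sh_x ->].
  rewrite pairwise_cons (perm_all _ (shuffle_perm sh_x)) all_cat e_a.
  have /andP[-> e_uv'] : all (e a) (b :: v) && allrel e u (b :: v).
    by rewrite -allrel_consl.
  have [eq_ak | neq_ak] := eqVneq a k.
    rewrite (pairwise_shuffle e_uv' _ sh_x) ?e_u; last first.
      apply/allrelP => y z y_v z_u; apply: e_after => //; first by rewrite inE z_u orbT.
      by rewrite -eq_ak (allP e_a).
    rewrite !andTb -[LHS]andbT; congr (_ && _); symmetry; apply/allP => c c_v.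
    by rewrite /= eq_ak eqxx -eq_ak a_v.
  rewrite (IHu x) //; last first.
  - by move=> y z y_u z_v; apply: e_after => //; rewrite inE y_u orbT.
  - by move: k_au; rewrite inE eq_sym (negPf neq_ak).
  rewrite !andTb; congr (_ && _); apply: eq_in_all => c c_v.
  by rewrite /= (negPf neq_ak) a_v.
(* A shuffle that starts with a letter of v puts it before k. *)
have k_x : k \in x by rewrite (perm_mem (shuffle_perm sh_x)) mem_cat k_au.
transitivity false.
  apply/negbTE; rewrite /= negb_and; apply/orP; left; apply/allPn; exists k => //.
  exact: not_e (mem_head b v).
by apply/esym/negbTE; rewrite /= eqxx ltn0 andbF.
Qed.

Section ThetaMorphism.
Context (K : fieldType).
Local Notation A := (FQSym K).
Local Notation wd := (fq_word K).

(** A cut of a linear extension is compatible with the order exactly when the letters of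
    the suffix form an upper set. *)
Lemma upper_allrel n (P : sposet n) (I : {set 'I_n}) a b :
  a =i ~: I -> b =i I -> allrel (follows P) a b = upper P I.
Proof.
move=> aI bI; apply/allrelP/forallP => [e_ab x | up x y].
  apply/implyP => x_I; apply/forallP => y; apply/implyP => le_xy.
  by apply: contraTT le_xy => y_I; apply: e_ab; rewrite ?aI ?bI ?inE.
rewrite aI bI inE => x_I y_I; apply: contra x_I => le_yx.
by have /implyP/(_ y_I)/forallP/(_ x)/implyP := up y; apply.
Qed.

(** Stated for an abstract tensor product and for both coproducts at once, [Q] being the
    identity or the negation. *)
Lemma coproduct_extsum (AA : tensor A A) (D : A -> AA) (Q : pred bool) n
    (P : sposet n.+1) :
  linear D ->
  (forall m w, uniq w -> is_top m w ->
    D (wd w) = \sum_(p <- splits w | Q (m \in p.1)) (wd p.1 ⊗ wd p.2)) ->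
  D (extsum K P (enum 'I_n.+1)) =
  \sum_(I : {set 'I_n.+1} | upper P I && Q (ord_max \notin I))
    (extsum K P (enum (~: I)) ⊗ extsum K P (enum I)).
Proof.
move=> D_lin D_wd; rewrite /extsum (linear_to_sum _ _ _ D_lin).
pose G (a b : seq 'I_n.+1) : AA :=
  if pairwise (follows P) (a ++ b) && Q (ord_max \in a)
  then wd (map val a) ⊗ wd (map val b) else 0.
transitivity (\sum_(w <- permutations (enum 'I_n.+1)) \sum_(p <- splits w) G p.1 p.2).
  rewrite big_mkcond; apply: eq_big_seq => w; rewrite mem_permutations => w_perm.
  have Uw : uniq w by rewrite (perm_uniq w_perm) enum_uniq.
  have val_top : is_top n (map val w).
    apply/andP; split; last by apply/allP => _ /mapP[i _ ->]; rewrite -ltnS ltn_ord.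
    by apply/mapP; exists ord_max; rewrite // (perm_mem w_perm) mem_enum.
  case: ifP => w_lin; last first.
    rewrite big_seq big1 // => p; rewrite mem_splits => /eqP def_w.
    by rewrite /G def_w w_lin.
  rewrite (D_wd n) // ?map_inj_uniq //; last exact: val_inj.
  rewrite map_splits big_map big_mkcond; apply: eq_big_seq => p.
  rewrite mem_splits => /eqP def_w; rewrite /G def_w w_lin /=.
  by rewrite -[n in n \in _]/(val (@ord_max n)) (mem_map val_inj).
rewrite sum_splits_permutations [RHS]big_mkcond; apply: eq_bigr => I _.
transitivity (\sum_(a <- permutations (enum (~: I))) \sum_(b <- permutations (enum I))
    if upper P I && Q (ord_max \notin I) then
      (if pairwise (follows P) a then wd (map val a) else 0) ⊗
      (if pairwise (follows P) b then wd (map val b) else 0) else 0 : AA).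
  apply: eq_big_seq => a; rewrite mem_permutations => a_I.
  apply: eq_big_seq => b; rewrite mem_permutations => b_I.
  have aI : a =i ~: I by move=> x; rewrite (perm_mem a_I) mem_enum.
  have bI : b =i I by move=> x; rewrite (perm_mem b_I) mem_enum.
  rewrite /G pairwise_cat (upper_allrel _ aI bI) aI inE.
  have [tl tr] := tmul_bilinear AA.
  case: (upper P I) => //=; case: (pairwise _ a); case: (pairwise _ b) => /=;
    by rewrite ?(linear_to0 (tl _)) ?(linear_to0 (tr _)) ?if_same.
case: ifP => _; last by rewrite big1 // => a _; rewrite big1.
have [tl tr] := tmul_bilinear AA.
rewrite [X in X ⊗ _]big_mkcond [X in _ ⊗ X]big_mkcond.
rewrite (linear_to_sum (f := fun x => x ⊗ _) _ _ _ (tl _)).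
by apply: eq_bigr => a _; rewrite (linear_to_sum _ _ _ (tr _)).
Qed.

Lemma enum_split_ord m n : perm_eq (enum 'I_(m + n))
  (map (@lshift m n) (enum 'I_m) ++ map (@rshift m n) (enum 'I_n)).
Proof.
apply: uniq_perm => [||i]; first exact: enum_uniq.
  rewrite cat_uniq (map_inj_uniq (@lshift_inj _ _)) (map_inj_uniq (@rshift_inj _ _)).
  rewrite !enum_uniq andbT; apply/hasPn => _ /mapP[i _ ->]; apply/mapP => -[j _ /eqP].
  by rewrite eq_rlshift.
rewrite mem_enum inE mem_cat; case: (split_ordP i) => j ->.
  by rewrite map_f // mem_enum.
by rewrite orbC map_f // mem_enum.
Qed.

Lemma extsum_split m n (R : sposet (m + n)) :
  extsum K R (enum 'I_(m + n)) =
  \sum_(u <- permutations (enum 'I_m)) \sum_(v <- permutations (enum 'I_n))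
    \sum_(w <- shuffle (map (@lshift m n) u) (map (@rshift m n) v))
       if pairwise (follows R) w then wd (map val w) else 0.
Proof.
rewrite (eq_extsum K R (enum_split_ord m n)) /extsum big_mkcond.
rewrite sum_permutations_cat; last by rewrite -(perm_uniq (enum_split_ord m n)) enum_uniq.
rewrite (sum_permutations_map _ (@lshift_inj _ _)) ?enum_uniq //.
by apply: eq_bigr => u _; rewrite (sum_permutations_map _ (@rshift_inj _ _)) ?enum_uniq.
Qed.

Section Blocks.
Variables (m n : nat) (u : seq 'I_m.+1) (v : seq 'I_n.+1).
Hypotheses (u_perm : perm_eq u (enum 'I_m.+1)) (v_perm : perm_eq v (enum 'I_n.+1)).

Let a := map (@lshift m.+1 n.+1) u.
Let b := map (@rshift m.+1 n.+1) v.

Lemma block_uniq : uniq (a ++ b).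
Proof.
have ab : perm_eq (a ++ b)
    (map (@lshift m.+1 n.+1) (enum 'I_m.+1) ++ map (@rshift m.+1 n.+1) (enum 'I_n.+1)).
  by apply: perm_cat; apply: perm_map.
by rewrite (perm_uniq ab) -(perm_uniq (enum_split_ord _ _)) enum_uniq.
Qed.

Lemma block_ltn : allrel ltn (map val a) (map val b).
Proof.
apply/allrelP => _ _ /mapP[_ /mapP[i _ ->] ->] /mapP[_ /mapP[j _ ->] ->] /=.
exact: leq_trans (ltn_ord i) (leq_addr _ _).
Qed.

Lemma block_word_l : wd (map val a) = wd (map val u).
Proof. by rewrite -map_comp; congr wd; apply: eq_map. Qed.

Lemma block_word_r : wd (map val b) = wd (map val v).
Proof.
rewrite -map_comp (_ : map _ v = map (addn m.+1) (map val v)); last by rewrite -map_comp.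
rewrite fq_word_map // => [|x y _ _]; last by rewrite ltn_add2l.
by rewrite map_inj_uniq ?(perm_uniq v_perm) ?enum_uniq //; apply: val_inj.
Qed.

Lemma block_top : is_top m (map val a).
Proof.
apply/andP; split.
  rewrite -map_comp; apply/mapP; exists ord_max => //.
  by rewrite (perm_mem u_perm) mem_enum.
by apply/allP => _ /mapP[_ /mapP[i _ ->] ->]; rewrite -ltnS; apply: ltn_ord i.
Qed.

Lemma block_r_n0 : map val b != [::].
Proof.
by rewrite -size_eq0 !size_map (perm_size v_perm) size_enum_ord.
Qed.

Lemma block_uniq_val : uniq (map val a) /\ uniq (map val b).
Proof.
have := block_uniq; rewrite -(map_inj_uniq val_inj) map_cat cat_uniq.
by case/and3P.
Qed.

Lemma mul_block : ddmul (FQSym_ops K) (wd (map val u)) (wd (map val v)) =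
  \sum_(w <- shuffle a b) wd (map val w).
Proof.
have [Ua Ub] := block_uniq_val; rewrite -block_word_l -block_word_r.
rewrite (mul_fq_word K Ua Ub block_ltn) ?block_r_n0 ?(top_nonempty block_top) //.
by rewrite map_shuffle big_map.
Qed.

Lemma nw_block : ddnw (FQSym_ops K) (wd (map val u)) (wd (map val v)) =
  \sum_(w <- nw_shuffle (lshift n.+1 ord_max) a b) wd (map val w).
Proof.
have [Ua Ub] := block_uniq_val; rewrite -block_word_l -block_word_r.
rewrite (nw_fq_word K Ua Ub block_ltn block_top) ?block_r_n0 //.
rewrite -(big_map (map val) xpredT wd) -map_nw_shuffle // => x y _ _; exact: val_inj.
Qed.

End Blocks.

Lemma follows_mul m n (P : sposet m) (Q : sposet n) u v w :
  w \in shuffle (map (@lshift m n) u) (map (@rshift m n) v) ->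
  pairwise (follows (sp_mul P Q)) w = pairwise (follows P) u && pairwise (follows Q) v.
Proof.
have lr i j : le1 (sp_mul P Q) (lshift n i) (rshift m j) = false.
  by rewrite sposet_ofE /sp_mul_rel (unsplitK (inl i)) (unsplitK (inr j)).
have rl i j : le1 (sp_mul P Q) (rshift m i) (lshift n j) = false.
  by rewrite sposet_ofE /sp_mul_rel (unsplitK (inr i)) (unsplitK (inl j)).
move=> w_uv; rewrite (pairwise_shuffle _ _ w_uv) ?pairwise_map.
- congr (_ && _); apply: eq_pairwise => i j; rewrite /follows /= sposet_ofE /sp_mul_rel.
    by rewrite !(unsplitK (inl _)).
  by rewrite !(unsplitK (inr _)).
- by apply/allrelP => _ _ /mapP[i _ ->] /mapP[j _ ->]; rewrite /follows rl.
- by apply/allrelP => _ _ /mapP[i _ ->] /mapP[j _ ->]; rewrite /follows lr.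
Qed.

Lemma follows_nw m n (P : sposet m.+1) (Q : sposet n.+1) u v w :
  perm_eq u (enum 'I_m.+1) -> perm_eq v (enum 'I_n.+1) ->
  w \in shuffle (map (@lshift m.+1 n.+1) u) (map (@rshift m.+1 n.+1) v) ->
  pairwise (follows (sp_nw P Q)) w =
  [&& pairwise (follows P) u, pairwise (follows Q) v &
      w \in nw_shuffle (lshift n.+1 ord_max)
              (map (@lshift m.+1 n.+1) u) (map (@rshift m.+1 n.+1) v)].
Proof.
move=> u_perm v_perm w_uv.
have lr i j : le1 (sp_nw P Q) (lshift n.+1 i) (rshift m.+1 j) = le1 P i ord_max.
  by rewrite sposet_ofE /sp_nw_rel (unsplitK (inl i)) (unsplitK (inr j)).
have rl i j : le1 (sp_nw P Q) (rshift m.+1 i) (lshift n.+1 j) = false.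
  by rewrite sposet_ofE /sp_nw_rel (unsplitK (inr i)) (unsplitK (inl j)).
have ll i j : le1 (sp_nw P Q) (lshift n.+1 i) (lshift n.+1 j) = le1 P i j.
  by rewrite sposet_ofE /sp_nw_rel !(unsplitK (inl _)).
have rr i j : le1 (sp_nw P Q) (rshift m.+1 i) (rshift m.+1 j) = le1 Q i j.
  by rewrite sposet_ofE /sp_nw_rel !(unsplitK (inr _)).
have fu : pairwise (follows (sp_nw P Q)) (map (@lshift m.+1 n.+1) u) = pairwise (follows P) u.
  by rewrite pairwise_map; apply: eq_pairwise => i j; rewrite /follows /= ll.
have fv : pairwise (follows (sp_nw P Q)) (map (@rshift m.+1 n.+1) v) = pairwise (follows Q) v.
  by rewrite pairwise_map; apply: eq_pairwise => i j; rewrite /follows /= rr.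
have [u_lin | u_nlin] := boolP (pairwise (follows P) u); last first.
  apply/negbTE; apply: contra u_nlin => w_lin; rewrite -fu.
  exact: subseq_pairwise (shuffle_subseq w_uv) w_lin.
have Uuv := block_uniq u_perm v_perm.
have max_u : lshift n.+1 ord_max \in map (@lshift m.+1 n.+1) u.
  by rewrite map_f // (perm_mem u_perm) mem_enum.
rewrite (@pairwise_nw_shuffle _ _ (lshift n.+1 ord_max) _ _ _ Uuv max_u _ _ _ _ w_uv).
- by rewrite fv nw_shuffleE // mem_filter w_uv andbT.
- by apply/allrelP => _ _ /mapP[i _ ->] /mapP[j _ ->]; rewrite /follows rl.
- have [Pr _ _] := le1_porder P.
  by move=> _ /mapP[i _ ->]; rewrite /follows lr Pr.
- by move=> _ _ /mapP[i _ ->] /mapP[j _ ->]; rewrite /follows lr ll.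
- by rewrite fu.
Qed.

Lemma mul_extsum m n (P : sposet m.+1) (Q : sposet n.+1) :
  extsum K (sp_mul P Q) (enum 'I_(m.+1 + n.+1)) =
  ddmul (FQSym_ops K) (extsum K P (enum 'I_m.+1)) (extsum K Q (enum 'I_n.+1)).
Proof.
have [ml mr] : bilinear_map (ddmul (FQSym_ops K)) by apply: bilinext_bilinear.
rewrite extsum_split [X in ddmul _ X _]/extsum [X in ddmul _ X _]big_mkcond.
rewrite (linear_to_sum _ _ _ (ml _)).
apply: eq_big_seq => u; rewrite mem_permutations => u_perm.
rewrite [X in ddmul _ _ X]/extsum [X in ddmul _ _ X]big_mkcond.
rewrite (linear_to_sum _ _ _ (mr _)).
apply: eq_big_seq => v; rewrite mem_permutations => v_perm.
transitivity (\sum_(w <- shuffle (map (@lshift m.+1 n.+1) u) (map (@rshift m.+1 n.+1) v))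
   if pairwise (follows P) u && pairwise (follows Q) v then wd (map val w) else 0).
  by apply: eq_big_seq => w /(follows_mul P Q) ->.
rewrite sum_if0 -mul_block //.
by case: (pairwise _ u); case: (pairwise _ v);
  rewrite ?(linear_to0 (ml _)) ?(linear_to0 (mr _)).
Qed.

Lemma nw_extsum m n (P : sposet m.+1) (Q : sposet n.+1) :
  extsum K (sp_nw P Q) (enum 'I_(m.+1 + n.+1)) =
  ddnw (FQSym_ops K) (extsum K P (enum 'I_m.+1)) (extsum K Q (enum 'I_n.+1)).
Proof.
have [ml mr] : bilinear_map (ddnw (FQSym_ops K)) by apply: bilinext_bilinear.
rewrite extsum_split [X in ddnw _ X _]/extsum [X in ddnw _ X _]big_mkcond.
rewrite (linear_to_sum _ _ _ (ml _)).
apply: eq_big_seq => u; rewrite mem_permutations => u_perm.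
rewrite [X in ddnw _ _ X]/extsum [X in ddnw _ _ X]big_mkcond.
rewrite (linear_to_sum _ _ _ (mr _)).
apply: eq_big_seq => v; rewrite mem_permutations => v_perm.
set a := map _ u; set b := map _ v.
transitivity (if pairwise (follows P) u && pairwise (follows Q) v then
    \sum_(w <- shuffle a b | w \in nw_shuffle (lshift n.+1 ord_max) a b) wd (map val w) else 0).
  rewrite [X in if _ then X else _]big_mkcond -sum_if0.
  apply: eq_big_seq => w /(follows_nw P Q u_perm v_perm) ->; rewrite andbA.
  by case: (_ && _) (_ \in _) => [] [].
have max_a : lshift n.+1 ord_max \in a by rewrite map_f // (perm_mem u_perm) mem_enum.
have -> : \sum_(w <- shuffle a b | w \in nw_shuffle (lshift n.+1 ord_max) a b) wd (map val w) =
    ddnw (FQSym_ops K) (wd (map val u)) (wd (map val v)).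
  rewrite nw_block // nw_shuffleE ?block_uniq // big_filter big_seq_cond [RHS]big_seq_cond.
  by apply: eq_bigl => w; rewrite mem_filter andbCA andbb andbC.
by case: (pairwise _ u); case: (pairwise _ v);
  rewrite ?(linear_to0 (ml _)) ?(linear_to0 (mr _)).
Qed.

Lemma Theta_lin : linear (@Theta K).
Proof. exact: linext_linear. Qed.

Lemma extsum_nil n (P : sposet n) : extsum K P [::] = 0.
Proof. by rewrite /extsum big_mkcond big_seq1. Qed.

Lemma Theta_basis n (P : sposet n.+1) :
  Theta << Tagged (fun n => sposet n.+1) P : sp_basis >> = extsum K P (enum 'I_n.+1).
Proof. exact: (ThetaE K P). Qed.

Lemma Theta_tensor_bil : bilinear_map (fun a b : HSP K => (Theta a ⊗ Theta b : FQSym2 K)).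
Proof.
have [tl tr] := tmul_bilinear (FQSym2 K).
by split=> c; [apply: (linear_comp (tl _) Theta_lin) | apply: (linear_comp (tr _) Theta_lin)].
Qed.

(** The trivial upper sets can be added or removed freely: their cuts have an empty
    piece, which [Theta] sends to zero. *)
Lemma Theta_cuts n (P : sposet n.+1) (Q : pred {set 'I_n.+1}) :
  tensor_map (FQSym2 K) (@Theta K)
    (\sum_(I : {set 'I_n.+1} | [&& upper P I, I != set0, I != setT & Q I])
      (sp_elt K (sp_res P (~: I)) ⊗ sp_elt K (sp_res P I) : HSP2 K)) =
  \sum_(I : {set 'I_n.+1} | upper P I && Q I)
    (extsum K P (enum (~: I)) ⊗ extsum K P (enum I)).
Proof.
rewrite /tensor_map (linear_to_sum _ _ _ (tlift_linear Theta_tensor_bil)).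
have [tl tr] := tmul_bilinear (FQSym2 K).
rewrite [LHS]big_mkcond [RHS]big_mkcond; apply: eq_bigr => I _.
have [-> | I_n0] := eqVneq I set0.
  by rewrite enum_set0 extsum_nil (linear_to0 (tr _)) andbF if_same.
have [-> | I_nT] := eqVneq I setT.
  by rewrite setCT enum_set0 extsum_nil (linear_to0 (tl _)) andbF if_same.
by rewrite (tlift_tmul _ Theta_tensor_bil) !Theta_res.
Qed.

Lemma Theta_morphism : dupdend_morphism (HSP_ops K) (FQSym_ops K) (@Theta K).
Proof.
have [mHl mHr] : bilinear_map (ddmul (HSP_ops K)) by apply: bilinext_bilinear.
have [nHl nHr] : bilinear_map (ddnw (HSP_ops K)) by apply: bilinext_bilinear.
have [ml mr] : bilinear_map (ddmul (FQSym_ops K)) by apply: bilinext_bilinear.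
have [nl nr] : bilinear_map (ddnw (FQSym_ops K)) by apply: bilinext_bilinear.
have pF : linear (ddprec (FQSym_ops K)) by apply: linext_linear.
have sF : linear (ddsucc (FQSym_ops K)) by apply: linext_linear.
have pH : linear (ddprec (HSP_ops K)) by apply: linext_linear.
have sH : linear (ddsucc (HSP_ops K)) by apply: linext_linear.
have Theta_lin := Theta_lin.
have TT : linear (tensor_map (FQSym2 K) (@Theta K) : HSP2 K -> FQSym2 K).
  exact: tlift_linear Theta_tensor_bil.
split=> //.
- move=> x y; move: x; apply: malg_linear_ext.
  + exact: (linear_comp Theta_lin (mHl y)).
  + exact: (linear_comp (ml _) Theta_lin).
  move=> [m P]; move: y; apply: malg_linear_ext.
  + exact: (linear_comp Theta_lin (mHr _)).
  + exact: (linear_comp (mr _) Theta_lin).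
  move=> [n Q]; rewrite !Theta_basis -mul_extsum /ddmul /= bilinextU.
  exact: ThetaE.
- move=> x y; move: x; apply: malg_linear_ext.
  + exact: (linear_comp Theta_lin (nHl y)).
  + exact: (linear_comp (nl _) Theta_lin).
  move=> [m P]; move: y; apply: malg_linear_ext.
  + exact: (linear_comp Theta_lin (nHr _)).
  + exact: (linear_comp (nr _) Theta_lin).
  move=> [n Q]; rewrite !Theta_basis -nw_extsum /ddnw /= bilinextU.
  exact: ThetaE.
- apply: malg_linear_ext.
  + exact: (linear_comp pF Theta_lin).
  + exact: (linear_comp TT pH).
  move=> [n P]; rewrite Theta_basis.
  rewrite (coproduct_extsum (Q := id) P pF (@prec_fq_word K)).
  rewrite -(Theta_cuts P (fun I => ord_max \notin I)).
  by rewrite /ddprec /= linextU.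
- apply: malg_linear_ext.
  + exact: (linear_comp sF Theta_lin).
  + exact: (linear_comp TT sH).
  move=> [n P]; rewrite Theta_basis.
  rewrite (coproduct_extsum (Q := negb) P sF (@succ_fq_word K)).
  rewrite (eq_bigl (fun I => upper P I && (ord_max \in I))) => [|I]; last by rewrite negbK.
  rewrite -(Theta_cuts P (fun I => ord_max \in I)).
  by rewrite /ddsucc /= linextU.
Qed.

End ThetaMorphism.

Theorem proposition5p5 (K : fieldType) :
  dupdend_bialgebra (FQSym3 K) (FQSym_ops K) /\
  dupdend_morphism (HSP_ops K) (FQSym_ops K) (@Theta K).
Proof. by split; [apply: FQSym_dupdend | apply: Theta_morphism]. Qed.
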